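(* Let $\mathcal{R}$ be an injective von Neumann algebra on a Hilbert space $H$ and let $\alpha_g$ be an action of a discrete countable group $G$ on $\mathcal{R}$ by $*$-automorphisms. Then there exists an unbounded expectation $(\chi,\sigma)$ of $B(H\otimes\ell_2(G))$ onto $\mathcal{L}(\mathcal{R},\alpha,G)$.
   Context: Crossed product. Let $(\delta_g)_{g\in G}$ be the canonical orthonormal basis of $\ell_2(G)$, $\lambda_g$ the left translation unitaries, $\lambda_g\delta_h=\delta_{gh}$, and $(e_{(g,h)})_{g,h\in G}$ the canonical matrix units of $B(\ell_2(G))$. Define $L_g:=I_H\otimes\lambda_g$ and the normal faithful representation $\Psi(r):=\sum_{g\in G}\alpha_{g^{-1}}(r)\otimes e_{(g,g)}$ of $\mathcal{R}$ on $H\otimes\ell_2(G)$. The crossed product von Neumann algebra $\mathcal{L}(\mathcal{R},\alpha,G)$ is the ultra-weak closure of $\mathrm{span}\{L_g\Psi(r): g\in G, r\in\mathcal{R}\}$ in $B(H\otimes\ell_2(G))$. A bounded operator $x$ on $H\otimes\ell_2(G)$ is written as a block matrix $x=\sum_{g,h}x_{(g,h)}\otimes e_{(g,h)}$ with $x_{(g,h)}\in B(H)$, and $\mathrm{Diag}(x):=\sum_{g}x_{(g,g)}\otimes e_{(g,g)}$. Unbounded expectation. An unbounded expectation of $B(H\otimes\ell_2(G))$ to (onto) $\mathcal{L}(\mathcal{R},\alpha,G)$ is a pair $(\chi,\sigma)$ where $\sigma:B(H\otimes\ell_2(G))\to\mathcal{L}(\mathcal{R},\alpha,G)$ is a linear,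 unital, completely positive, $\Psi(\mathcal{R})$-bimodular mapping (i.e. $\sigma(\Psi(r)x\Psi(s))=\Psi(r)\sigma(x)\Psi(s)$ for $r,s\in\mathcal{R}$) and $\chi$ is a positive definite and strictly positive function on $G$ (i.e. $\chi(g)>0$ for all $g$) such that: (i) for all $g\in G$ and $r\in\mathcal{R}$, $\sigma(L_g\Psi(r))=\chi(g)L_g\Psi(r)$; (ii) for all $x\in B(H\otimes\ell_2(G))$ and $g\in G$, $\|\mathrm{Diag}(L_{g^{-1}}\sigma(x))\|\le\chi(g)\|x\|$. *)

(* Defs.v *)
From HB Require Import structures.
From mathcomp Require Import all_boot all_order all_algebra.
From mathcomp Require Import complex lra finmap.
From mathcomp Require Import boolp classical_sets functions cardinality fsbigop.
From mathcomp Require Import reals ereal topology normedtype esum numfun.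

Set Implicit Arguments.
Unset Strict Implicit.
Unset Printing Implicit Defensive.

Import Order.TTheory GRing.Theory Num.Theory.
Import numFieldNormedType.Exports.

Local Open Scope classical_set_scope.
Local Open Scope ring_scope.
Local Open Scope complex_scope.

(* The norm of a normed module over R[i] takes its values in R[i]. *)
Definition rnorm {R : realType} {V : normedModType R[i]} (x : V) : R :=
  complex.Re `|x|.

Section RealNorm.
Context {R : realType} {V : normedModType R[i]}.
Implicit Types x y : V.

Lemma rnormE x : `|x| = (rnorm x)%:C.
Proof. by rewrite /rnorm RRe_real// normr_real. Qed.

Lemma rnorm_ge0 x : 0 <= rnorm x.
Proof. by rewrite -ler0c -rnormE. Qed.

Lemma rnormD x y : rnorm (x + y) <= rnorm x + rnorm y.
Proof. by rewrite -lecR rmorphD/= -!rnormE ler_normD. Qed.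

Lemma rnormZ (a : R[i]) x : rnorm (a *: x) = complex.Re `|a| * rnorm x.
Proof.
apply: (@complexI R); rewrite -rnormE normrZ rnormE rmorphM/=.
by rewrite RRe_real// normr_real.
Qed.

Lemma rnormN x : rnorm (- x) = rnorm x.
Proof. by rewrite /rnorm normrN. Qed.

End RealNorm.

(* The inner product is linear in its first argument. *)
HB.mixin Record isHilbert (R : realType) H & CompleteNormedModule R[i] H := {
  inner : H -> H -> R[i];
  inner_linearl : forall (a : R[i]) (x y z : H),
    inner (a *: x + y) z = a * inner x z + inner y z;
  inner_conj : forall x y : H, inner y x = (inner x y)^*;
  inner_normE : forall x : H, inner x x = `|x| ^+ 2
}.

#[short(type="hilbertType")]
HB.structure Definition Hilbert (R : realType) :=
  {H of CompleteNormedModule R[i] H & isHilbert R H}.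

Section HilbertTheory.
Context {R : realType} {H : hilbertType R}.
Implicit Types x y z : H.

Lemma innerDl x y z : inner (x + y) z = inner x z + inner y z.
Proof. by rewrite -{1}[x]scale1r inner_linearl mul1r. Qed.

Lemma inner0l z : inner (0 : H) z = 0.
Proof. by apply: (addrI (inner 0 z)); rewrite -innerDl !addr0. Qed.

Lemma innerZl (a : R[i]) x z : inner (a *: x) z = a * inner x z.
Proof. by rewrite -[a *: x]addr0 inner_linearl inner0l addr0. Qed.

Lemma innerDr x y z : inner z (x + y) = inner z x + inner z y.
Proof. by rewrite inner_conj innerDl rmorphD/= -!inner_conj. Qed.

Lemma innerZr (a : R[i]) x z : inner z (a *: x) = a^* * inner z x.
Proof. by rewrite inner_conj innerZl rmorphM/= -inner_conj. Qed.

Lemma inner_rnormE x : inner x x = (rnorm x ^+ 2)%:C.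
Proof. by rewrite inner_normE rnormE -rmorphXn. Qed.

Lemma rnorm_sqrD x y :
  rnorm (x + y) ^+ 2 = rnorm x ^+ 2 + rnorm y ^+ 2 + 2 * complex.Re (inner x y).
Proof.
have twoE (r : R) : (2 * r)%:C = 2 * r%:C by rewrite rmorphM rmorph_nat.
apply: (@complexI R); rewrite -inner_rnormE innerDl !innerDr !inner_rnormE.
rewrite [inner y x]inner_conj !rmorphD/= twoE.
by rewrite -addrA (addrA (inner x y)) addcJ [X in _ + X]addrC addrA.
Qed.

Lemma innerNr x y : inner x (- y) = - inner x y.
Proof. by rewrite -scaleN1r innerZr rmorphN1 mulN1r. Qed.

Lemma Re_inner_le x y : `|complex.Re (inner x y)| <= rnorm x ^+ 2 + rnorm y ^+ 2.
Proof.
have h1 := rnorm_sqrD x y; have h2 := rnorm_sqrD x (- y).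
move: h2; rewrite innerNr rnormN raddfN/= => h2.
have p1 := sqr_ge0 (rnorm (x + y)); have p2 := sqr_ge0 (rnorm (x - y)).
have p3 := sqr_ge0 (rnorm x); have p4 := sqr_ge0 (rnorm y).
rewrite ler_norml; apply/andP; split; lra.
Qed.

Lemma Im_inner x y : complex.Im (inner x y) = complex.Re (inner x ('i *: y)).
Proof.
by rewrite innerZr; case: (inner x y) => a b /=; rewrite mul0r mulN1r sub0r opprK.
Qed.

Lemma Im_inner_le x y : `|complex.Im (inner x y)| <= rnorm x ^+ 2 + rnorm y ^+ 2.
Proof.
rewrite Im_inner (le_trans (Re_inner_le _ _))// rnormZ.
by rewrite /= expr0n/= add0r expr1n sqrtr1 mul1r.
Qed.

End HilbertTheory.

Section RealSums.
Context {R : realType} {I : choiceType}.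
Implicit Types f g p q : I -> R.

Definition rsummable f : Prop := summable setT (EFin \o f).

(* Unordered sum of a summable family. *)
Definition rsum f : R :=
  fine (\esum_(i in setT) (EFin \o f)^\+ i - \esum_(i in setT) (EFin \o f)^\- i)%E.

Definition nnsum p : \bar R := \esum_(i in setT) (p i)%:E.

Lemma rsummable_nn p : (forall i, 0 <= p i) -> rsummable p <-> (nnsum p < +oo)%E.
Proof.
move=> p0; rewrite /rsummable /summable /nnsum.
by under eq_esum do rewrite /= ger0_norm//.
Qed.

Lemma nnsum_ge0 p : (forall i, 0 <= p i) -> (0 <= nnsum p)%E.
Proof. by move=> p0; apply: esum_ge0 => i _; rewrite lee_fin. Qed.

Lemma nnsum_fin p : (forall i, 0 <= p i) -> rsummable p -> nnsum p \is a fin_num.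
Proof. by move=> p0 /(rsummable_nn p0) sp; rewrite ge0_fin_numE// nnsum_ge0. Qed.

Lemma nnsum_ge p (J : {fset I}) : (forall i, 0 <= p i) ->
  ((\sum_(i <- J) p i)%:E <= nnsum p)%E.
Proof.
move=> p0; apply: esum_ge; exists [set` J]; first by split.
by rewrite fsbig_finite//= set_fsetK sumEFin.
Qed.

Lemma nnsum_le p (c : R) : (forall J : {fset I}, \sum_(i <- J) p i <= c) ->
  (nnsum p <= c%:E)%E.
Proof.
move=> h; apply: ge_ereal_sup => _ [A [finA _] <-].
by rewrite fsbig_finite//= sumEFin lee_fin.
Qed.

Lemma rsummable_le f p : (forall i, `|f i| <= p i) -> rsummable p -> rsummable f.
Proof.
move=> fp; apply: le_lt_trans; apply: le_esum => i _ /=.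
by rewrite lee_fin (le_trans (fp i))// ler_norm.
Qed.

Lemma rsummableD f g : rsummable f -> rsummable g ->
  rsummable (fun i => f i + g i).
Proof. by move=> sf sg; have := summableD sf sg. Qed.

Lemma nnsumZ (a : R) p : (forall i, 0 <= p i) -> 0 <= a -> rsummable p ->
  nnsum (fun i => a * p i) = (a%:E * nnsum p)%E.
Proof.
move=> p0 a0 sp.
have key (b : R) q : 0 <= b -> (forall i, 0 <= q i) -> rsummable q ->
    (nnsum (fun i => b * q i)%R <= b%:E * nnsum q)%E.
  move=> b0 q0 sq; rewrite -(fineK (nnsum_fin q0 sq)) -EFinM.
  apply: nnsum_le => J; rewrite -mulr_sumr ler_wpM2l//.
  by rewrite -lee_fin fineK ?nnsum_fin// nnsum_ge.
apply/eqP; rewrite eq_le key//=.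
have [->|aN0] := eqVneq a 0; first by rewrite mul0e nnsum_ge0// => i; rewrite mul0r.
have ap : 0 < a by rewrite lt_neqAle eq_sym aN0.
have ap0 i : 0 <= a * p i by rewrite mulr_ge0.
have sap : rsummable (fun i => a * p i).
  apply/(rsummable_nn ap0); apply: le_lt_trans (key _ _ a0 p0 sp) _.
  by rewrite -(fineK (nnsum_fin p0 sp)) -EFinM ltry.
have aV0 : 0 <= a^-1 by rewrite invr_ge0.
have := key _ _ aV0 ap0 sap.
rewrite (_ : (fun i => a^-1 * (a * p i)) = p); last first.
  by apply/funext => i; rewrite mulKf.
rewrite -(fineK (nnsum_fin p0 sp)) -(fineK (nnsum_fin ap0 sap)) -!EFinM !lee_fin.
by rewrite ler_pdivlMl.
Qed.

Lemma rsummableZ (a : R) f : rsummable f -> rsummable (fun i => a * f i).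
Proof.
move=> sf.
have n0 i : 0 <= `|f i| by [].
have sn : rsummable (fun i => `|f i|).
  by apply/(rsummable_nn n0); apply: le_lt_trans sf; apply: le_esum => i _ /=.
apply: (@rsummable_le _ (fun i => `|a| * `|f i|)); first by move=> i; rewrite normrM.
apply/(rsummable_nn (fun i => mulr_ge0 (normr_ge0 a) (n0 i))).
by rewrite nnsumZ// -(fineK (nnsum_fin n0 sn)) -EFinM ltry.
Qed.

Lemma rsumB p q : (forall i, 0 <= p i) -> (forall i, 0 <= q i) ->
  rsummable p -> rsummable q ->
  rsum (fun i => p i - q i) = fine (nnsum p) - fine (nnsum q).
Proof.
move=> p0 q0 sp sq; rewrite /rsum.
have -> : EFin \o (fun i => p i - q i) = ((EFin \o p) \- (EFin \o q))%E by [].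
rewrite esumB// => [|i _|i _]; rewrite ?lee_fin//.
by rewrite fineB// ?nnsum_fin.
Qed.

Lemma rsum_nn p : (forall i, 0 <= p i) -> rsummable p -> rsum p = fine (nnsum p).
Proof.
move=> p0 sp.
have s0 : rsummable (fun=> 0 : R).
  by apply: rsummable_le sp => i; rewrite normr0.
have := rsumB p0 (fun=> lexx 0) sp s0.
rewrite [nnsum (fun=> 0)]esum1// subr0 => <-.
by congr rsum; apply/funext => i; rewrite subr0.
Qed.

Let pos f i := Num.max (f i) 0.
Let neg f i := Num.max (- f i) 0.

Let pos_ge0 f i : 0 <= pos f i. Proof. by rewrite le_max lexx orbT. Qed.
Let neg_ge0 f i : 0 <= neg f i. Proof. by rewrite le_max lexx orbT. Qed.
Let posneg f i : f i = pos f i - neg f i.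
Proof.
rewrite /pos /neg; case: (leP (f i) 0) => h.
  by rewrite max_l ?oppr_ge0// sub0r opprK.
by rewrite max_r ?subr0// oppr_le0 ltW.
Qed.
Let pos_sum f : rsummable f -> rsummable (pos f).
Proof.
apply: le_lt_trans; apply: le_esum => i _ /=; rewrite lee_fin /pos.
by case: (leP (f i) 0) => h //; rewrite normr0.
Qed.
Let neg_sum f : rsummable f -> rsummable (neg f).
Proof.
apply: le_lt_trans; apply: le_esum => i _ /=; rewrite lee_fin /neg.
by case: (leP (- f i) 0) => h //; rewrite ?normr0// normrN.
Qed.

Lemma nnsumD p q : (forall i, 0 <= p i) -> (forall i, 0 <= q i) ->
  nnsum (fun i => p i + q i) = (nnsum p + nnsum q)%E.
Proof.
by move=> p0 q0; rewrite /nnsum -esumD// => i _; rewrite lee_fin.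
Qed.

Let rsum_posneg f : rsummable f ->
  rsum f = fine (nnsum (pos f)) - fine (nnsum (neg f)).
Proof.
move=> sf; rewrite {1}(funext (posneg f)).
by apply: rsumB => //; [exact: pos_sum|exact: neg_sum].
Qed.

Lemma rsumD f g : rsummable f -> rsummable g ->
  rsum (fun i => f i + g i) = rsum f + rsum g.
Proof.
move=> sf sg.
have [pf nf] := (pos_sum sf, neg_sum sf); have [pg ng] := (pos_sum sg, neg_sum sg).
have -> : (fun i => f i + g i) =
    (fun i => (pos f i + pos g i) - (neg f i + neg g i)).
  by apply/funext => i; rewrite {1}(posneg f) {1}(posneg g) opprD addrACA.
rewrite rsumB; last 4 first.
- by move=> i; rewrite addr_ge0.
- by move=> i; rewrite addr_ge0.
- exact: rsummableD.
- exact: rsummableD.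
rewrite !nnsumD// !fineD ?nnsum_fin// (rsum_posneg sf) (rsum_posneg sg).
by rewrite opprD addrACA.
Qed.

Lemma rsumN f : rsummable f -> rsum (fun i => - f i) = - rsum f.
Proof.
move=> sf; rewrite (rsum_posneg sf).
have -> : (fun i => - f i) = (fun i => neg f i - pos f i).
  by apply/funext => i; rewrite {1}(posneg f) opprB.
by rewrite rsumB ?opprB//; [exact: neg_sum|exact: pos_sum].
Qed.

Lemma rsumZ (a : R) f : rsummable f -> rsum (fun i => a * f i) = a * rsum f.
Proof.
move=> sf; have [pf nf] := (pos_sum sf, neg_sum sf).
have key b : 0 <= b -> rsum (fun i => b * f i) = b * rsum f.
  move=> b0; have -> : (fun i => b * f i) = (fun i => b * pos f i - b * neg f i).
    by apply/funext => i; rewrite {1}(posneg f) mulrBr.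
  rewrite rsumB; last 4 first.
  - by move=> i; rewrite mulr_ge0.
  - by move=> i; rewrite mulr_ge0.
  - exact: rsummableZ.
  - exact: rsummableZ.
  by rewrite !nnsumZ// !fineM ?nnsum_fin//= -mulrBr (rsum_posneg sf).
have [a0|a0] := leP 0 a; first exact: key.
have -> : (fun i => a * f i) = (fun i => - (- a * f i)).
  by apply/funext => i; rewrite mulNr opprK.
rewrite rsumN; last exact: rsummableZ.
by rewrite key ?oppr_ge0 ?ltW// mulNr opprK.
Qed.

End RealSums.

Section ComplexSums.
Context {R : realType} {I : choiceType}.
Implicit Types z w : I -> R[i].

Definition csummable z : Prop :=
  rsummable (fun i => complex.Re (z i)) /\ rsummable (fun i => complex.Im (z i)).

Definition csum z : R[i] :=
  rsum (fun i => complex.Re (z i)) +i* rsum (fun i => complex.Im (z i)).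

Lemma csumD z w : csummable z -> csummable w ->
  csum (fun i => z i + w i) = csum z + csum w.
Proof.
move=> [rz iz] [rw iw]; rewrite /csum.
under [in X in X +i* _]eq_fun do rewrite raddfD/=.
under [in X in _ +i* X]eq_fun do rewrite raddfD/=.
by rewrite !rsumD.
Qed.

Lemma csumZ (a : R[i]) z : csummable z -> csum (fun i => a * z i) = a * csum z.
Proof.
case: a => a b [rz iz]; rewrite /csum.
have -> : (fun i => complex.Re ((a +i* b) * z i)) =
    (fun i => a * complex.Re (z i) + - b * complex.Im (z i)).
  by apply/funext => i; case: (z i) => x y /=; rewrite mulNr.
have -> : (fun i => complex.Im ((a +i* b) * z i)) =
    (fun i => a * complex.Im (z i) + b * complex.Re (z i)).
  by apply/funext => i; case: (z i) => x y /=.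
rewrite !rsumD; try exact: rsummableZ.
by rewrite !rsumZ// mulNr.
Qed.

Lemma csummableZ (a : R[i]) z : csummable z -> csummable (fun i => a * z i).
Proof.
case: a => a b [rz iz]; split.
- have -> : (fun i => complex.Re ((a +i* b) * z i)) =
      (fun i => a * complex.Re (z i) + - b * complex.Im (z i)).
    by apply/funext => i; case: (z i) => x y /=; rewrite mulNr.
  by apply: rsummableD; exact: rsummableZ.
- have -> : (fun i => complex.Im ((a +i* b) * z i)) =
      (fun i => a * complex.Im (z i) + b * complex.Re (z i)).
    by apply/funext => i; case: (z i) => x y /=.
  by apply: rsummableD; exact: rsummableZ.
Qed.

Lemma csum_conj z : csummable z -> csum (fun i => (z i)^*) = (csum z)^*.
Proof.
move=> [rz iz]; rewrite /csum /= -rsumN//.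
by congr Complex; congr rsum; apply/funext => i; case: (z i).
Qed.

Lemma csum_real (f : I -> R) : csum (fun i => (f i)%:C) = (rsum f)%:C.
Proof.
rewrite /csum /= (_ : rsum (fun=> 0) = 0)// rsum_nn//.
  by rewrite /nnsum esum1.
by apply/rsummable_nn => //; rewrite /nnsum esum1.
Qed.

End ComplexSums.

Section Ell2.
Context {R : realType} (I : choiceType) (H : hilbertType R).

Definition square_summable (f : I -> H) : Prop :=
  rsummable (fun i => rnorm (f i) ^+ 2).

Definition ell2_pred : {pred I -> H} := [pred f | `[< square_summable f >]].

Record ell2 := Ell2 { ell2_fun :> I -> H ; _ : ell2_fun \in ell2_pred }.

HB.instance Definition _ := [isSub of ell2 for ell2_fun].
HB.instance Definition _ := [Choice of ell2 by <:].

Let ell2_submod_closed : submod_closed ell2_pred.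
Proof.
have n0 (f : I -> H) i : 0 <= rnorm (f i) ^+ 2 by rewrite sqr_ge0.
split=> [|a f g /asboolP sf /asboolP sg]; apply/asboolP.
  apply/(rsummable_nn (n0 _)); rewrite /nnsum esum1// => i _.
  by rewrite /rnorm normr0 expr0n.
pose b := complex.Re `|a|.
apply: (@rsummable_le _ _ _
  (fun i => 2 * b ^+ 2 * rnorm (f i) ^+ 2 + 2 * rnorm (g i) ^+ 2)); last first.
  by apply: rsummableD; exact: rsummableZ.
move=> i; rewrite ger0_norm//.
have : rnorm (a *: f i + g i) <= b * rnorm (f i) + rnorm (g i).
  by rewrite -rnormZ rnormD.
rewrite -[(a *: f + g) i]/(a *: f i + g i).
have := rnorm_ge0 (a *: f i + g i).
set u := rnorm _; set v := b * _; set w := rnorm _ => u0 uvw.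
have : u ^+ 2 <= (v + w) ^+ 2 by rewrite ler_pXn2r ?nnegrE// (le_trans u0).
have := sqr_ge0 (v - w).
rewrite -mulrA -exprMn -/v sqrrB sqrrD; lra.
Qed.

HB.instance Definition _ := GRing.isSubmodClosed.Build R[i] (I -> H) ell2_pred
  ell2_submod_closed.
HB.instance Definition _ := [SubChoice_isSubLmodule of ell2 by <:].

Implicit Types f g : ell2.

Lemma ell2P f : square_summable f.
Proof. by case: f => f /= /asboolP. Qed.

Lemma ell2_eqP f g : (forall i, f i = g i) -> f = g.
Proof. by move=> fg; apply/val_inj/funext. Qed.

Lemma ell2DE f g i : (f + g) i = f i + g i. Proof. by []. Qed.
Lemma ell2ZE (a : R[i]) f i : (a *: f) i = a *: f i. Proof. by []. Qed.
Lemma ell2NE f i : (- f) i = - f i. Proof. by []. Qed.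

End Ell2.

Section Ell2Normed.
Context {R : realType} {I : choiceType} {H : hilbertType R}.
Implicit Types f g h : ell2 I H.

Definition ell2_inner f g : R[i] := csum (fun i => inner (f i) (g i)).
Local Arguments ell2_inner : simpl never.

Definition ell2_normsq f : R := rsum (fun i => rnorm (f i) ^+ 2).

Definition ell2_norm f : R[i] := (Num.sqrt (ell2_normsq f))%:C.

Let sq0 f i : 0 <= rnorm (f i) ^+ 2. Proof. exact: sqr_ge0. Qed.

Let csummable_inner f g : csummable (fun i => inner (f i) (g i)).
Proof.
have s : rsummable (fun i => rnorm (f i) ^+ 2 + rnorm (g i) ^+ 2).
  by apply: rsummableD; exact: ell2P.
split; apply: rsummable_le s => i; [exact: Re_inner_le|exact: Im_inner_le].
Qed.

Lemma ell2_normsqE f : (ell2_normsq f)%:E = nnsum (fun i => rnorm (f i) ^+ 2).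
Proof.
rewrite /ell2_normsq rsum_nn//; last exact: ell2P.
by rewrite fineK// nnsum_fin//; exact: ell2P.
Qed.

Lemma ell2_normsq_ge0 f : 0 <= ell2_normsq f.
Proof. by rewrite -lee_fin ell2_normsqE nnsum_ge0. Qed.

Lemma ell2_normsq_ge f (J : {fset I}) :
  \sum_(i <- J) rnorm (f i) ^+ 2 <= ell2_normsq f.
Proof. by rewrite -lee_fin ell2_normsqE nnsum_ge. Qed.

Lemma ell2_normsq_le f (c : R) :
  (forall J : {fset I}, \sum_(i <- J) rnorm (f i) ^+ 2 <= c) ->
  ell2_normsq f <= c.
Proof. by move=> h; rewrite -lee_fin ell2_normsqE nnsum_le. Qed.

Lemma ell2_normsq_ge1 f i : rnorm (f i) ^+ 2 <= ell2_normsq f.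
Proof.
by have := ell2_normsq_ge f [fset i]%fset; rewrite big_seq_fset1.
Qed.

Lemma ell2_normsq_eq0 f : ell2_normsq f = 0 -> f = 0.
Proof.
move=> f0; apply: ell2_eqP => i; apply/eqP; rewrite -normr_eq0 rnormE.
have : rnorm (f i) ^+ 2 == 0 by rewrite eq_le sq0 -f0 ell2_normsq_ge1.
by rewrite sqrf_eq0 => /eqP ->.
Qed.

Lemma ell2_inner_linearl (a : R[i]) f g h :
  ell2_inner (a *: f + g) h = a * ell2_inner f h + ell2_inner g h.
Proof.
rewrite /ell2_inner -csumZ -?csumD//; last exact: csummableZ.
by congr csum; apply/funext => i; rewrite ell2DE ell2ZE inner_linearl.
Qed.

Lemma ell2_inner_conj f g : ell2_inner g f = (ell2_inner f g)^*.
Proof.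
rewrite /ell2_inner -csum_conj//.
by congr csum; apply/funext => i; rewrite inner_conj.
Qed.

Lemma ell2_inner_normsq f : ell2_inner f f = (ell2_normsq f)%:C.
Proof.
rewrite /ell2_inner -csum_real.
by congr csum; apply/funext => i; rewrite inner_rnormE.
Qed.

Lemma ell2_normsqZ (a : R[i]) f :
  ell2_normsq (a *: f) = (complex.Re `|a|) ^+ 2 * ell2_normsq f.
Proof.
rewrite /ell2_normsq -rsumZ; last exact: ell2P.
by congr rsum; apply/funext => i; rewrite ell2ZE rnormZ exprMn.
Qed.

Let innerDl2 f g h : ell2_inner (f + g) h = ell2_inner f h + ell2_inner g h.
Proof. by rewrite -{1}[f]scale1r ell2_inner_linearl mul1r. Qed.

Let innerZl2 (a : R[i]) f h : ell2_inner (a *: f) h = a * ell2_inner f h.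
Proof.
rewrite /ell2_inner -csumZ//.
by congr csum; apply/funext => i; rewrite ell2ZE innerZl.
Qed.

Let inner0l2 h : ell2_inner 0 h = 0.
Proof. by rewrite -(scale0r (0 : ell2 I H)) innerZl2 mul0r. Qed.

Let innerDr2 f g h : ell2_inner h (f + g) = ell2_inner h f + ell2_inner h g.
Proof.
rewrite [LHS]ell2_inner_conj innerDl2 rmorphD.
by rewrite [ell2_inner h f]ell2_inner_conj [ell2_inner h g]ell2_inner_conj.
Qed.

Let innerZr2 (a : R[i]) f h : ell2_inner h (a *: f) = a^* * ell2_inner h f.
Proof. by rewrite [LHS]ell2_inner_conj innerZl2 rmorphM [ell2_inner h f]ell2_inner_conj. Qed.

Lemma ell2_normsqD f g :
  ell2_normsq (f + g) =
  ell2_normsq f + ell2_normsq g + 2 * complex.Re (ell2_inner f g).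
Proof.
have twoE (r : R) : (2 * r)%:C = 2 * r%:C by rewrite rmorphM rmorph_nat.
apply: (@complexI R); rewrite -ell2_inner_normsq innerDl2.
rewrite !innerDr2 !ell2_inner_normsq [ell2_inner g f]ell2_inner_conj.
rewrite !rmorphD/= twoE.
by rewrite -addrA (addrA (ell2_inner f g)) addcJ [X in _ + X]addrC addrA.
Qed.

Lemma ell2_Re_inner_le f g :
  complex.Re (ell2_inner f g) <= Num.sqrt (ell2_normsq f) * Num.sqrt (ell2_normsq g).
Proof.
set s := Num.sqrt (ell2_normsq f); set t := Num.sqrt (ell2_normsq g).
have s2 : s ^+ 2 = ell2_normsq f by rewrite sqr_sqrtr// ell2_normsq_ge0.
have t2 : t ^+ 2 = ell2_normsq g by rewrite sqr_sqrtr// ell2_normsq_ge0.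
have [s0|sN0] := eqVneq s 0.
  have -> : f = 0 by apply: ell2_normsq_eq0; rewrite -s2 s0 expr0n.
  by rewrite inner0l2 s0 mul0r.
have [t0|tN0] := eqVneq t 0.
  have -> : g = 0 by apply: ell2_normsq_eq0; rewrite -t2 t0 expr0n.
  by rewrite ell2_inner_conj inner0l2 conjc0 t0 mulr0.
have sp : 0 < s by rewrite lt_neqAle eq_sym sN0 sqrtr_ge0.
have tp : 0 < t by rewrite lt_neqAle eq_sym tN0 sqrtr_ge0.
have := ell2_normsq_ge0 (t%:C *: f + (- s%:C) *: g).
have Rn (r : R) : 0 < r -> complex.Re `|r%:C : R[i]| = r.
  by move=> r0; rewrite ger0_norm// ler0c ltW.
rewrite ell2_normsqD !ell2_normsqZ normrN (Rn s)// (Rn t)// -s2 -t2.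
have -> : complex.Re (ell2_inner (t%:C *: f) (- s%:C *: g)) =
    - (s * t * complex.Re (ell2_inner f g)).
  rewrite innerZl2 innerZr2; case: (ell2_inner f g) => a b /=.
  by rewrite !(mul0r, oppr0, subr0, mulNr, mulrN) mulrCA mulrA.
move=> h; have st0 : 0 < s * t by rewrite mulr_gt0.
rewrite -(ler_pM2l st0); nra.
Qed.

Lemma ell2_ler_normD f g : ell2_norm (f + g) <= ell2_norm f + ell2_norm g.
Proof.
rewrite /ell2_norm -rmorphD/= lecR -[leRHS]ger0_norm ?addr_ge0 ?sqrtr_ge0//.
rewrite -sqrtr_sqr ler_wsqrtr// ell2_normsqD sqrrD !sqr_sqrtr ?ell2_normsq_ge0//.
have := ell2_Re_inner_le f g; lra.
Qed.

Lemma ell2_normZ (a : R[i]) f : ell2_norm (a *: f) = `|a| * ell2_norm f.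
Proof.
have aE : (complex.Re `|a|)%:C = `|a| by rewrite RRe_real// normr_real.
rewrite /ell2_norm ell2_normsqZ sqrtrM ?sqr_ge0// sqrtr_sqr ger0_norm.
  by rewrite rmorphM -[X in _ = X * _]aE.
by rewrite -ler0c aE.
Qed.

Lemma ell2_norm_eq0 f : ell2_norm f = 0 -> f = 0.
Proof.
move=> /eqP; rewrite eq_complex/= eqxx andbT sqrtr_eq0 => f0.
by apply: ell2_normsq_eq0; apply/eqP; rewrite eq_le f0 ell2_normsq_ge0.
Qed.

HB.instance Definition _ := Lmodule_isNormed.Build R[i] (ell2 I H)
  ell2_ler_normD ell2_normZ ell2_norm_eq0.

Lemma ell2_rnormE f : rnorm f = Num.sqrt (ell2_normsq f).
Proof. by []. Qed.

Lemma ell2_rnorm_sqr f : rnorm f ^+ 2 = ell2_normsq f.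
Proof. by rewrite sqr_sqrtr// ell2_normsq_ge0. Qed.

Lemma ell2_inner_norm f : ell2_inner f f = `|f| ^+ 2.
Proof. by rewrite rnormE -rmorphXn/= ell2_rnorm_sqr ell2_inner_normsq. Qed.

Lemma ell2_coord_le f i : rnorm (f i) <= rnorm f.
Proof.
by rewrite -(ler_pXn2r (n := 2))// ?nnegrE ?rnorm_ge0// ell2_rnorm_sqr ell2_normsq_ge1.
Qed.

End Ell2Normed.

Section Ell2Complete.
Context {R : realType} {I : choiceType} {H : hilbertType R}.

Let posC (e : R[i]) : 0 < e -> exists2 r : R, 0 < r & r%:C = e.
Proof.
move=> e0; have eE : (complex.Re e)%:C = e by rewrite RRe_real// gtr0_real.
by exists (complex.Re e) => //; rewrite -ltcR eE.
Qed.

Let rnorm_dist (a x y : H) : `|rnorm (a - x) - rnorm (a - y)| <= rnorm (x - y).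
Proof.
have tri (u v : H) : rnorm (a - u) <= rnorm (u - v) + rnorm (a - v).
  have -> : a - u = (a - v) - (u - v) by rewrite opprB addrA subrK.
  by rewrite [leRHS]addrC -(rnormN (u - v)) rnormD.
rewrite ler_distl; apply/andP; split.
  by rewrite lerBlDl -(rnormN (x - y)) opprB tri.
by rewrite [leRHS]addrC tri.
Qed.

Let rnorm_cvg (T : Type) (F : set_system T) (FF : Filter F) (u : T -> H) (l : H) :
  u @ F --> l -> forall a : H, rnorm (a - u t) @[t --> F] --> rnorm (a - l).
Proof.
move=> ul a; apply/cvgrPdist_lt => /= e e0.
have e0C : 0 < e%:C :> R[i] by rewrite ltcR.
move/cvgrPdist_lt : ul => /(_ _ e0C); apply: filterS => t /=.
by rewrite rnormE ltcR; apply: le_lt_trans; exact: rnorm_dist.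
Qed.

Lemma ell2_complete (F : set_system (ell2 I H)) :
  ProperFilter F -> cauchy F -> cvg F.
Proof.
move=> FF /cauchy_ballP Fc.
have cauF (e : R) : 0 < e -> exists2 A, F A &
    forall f g, A f -> A g -> rnorm (f - g) < e.
  move=> e0; have e0C : 0 < e%:C :> R[i] by rewrite ltcR.
  have [[A B] /= [FA FB] AB] := Fc _ e0C.
  exists (A `&` B); first exact: filterI.
  move=> f g [Af _] [_ Bg]; have := AB (f, g) (conj Af Bg).
  by rewrite -ball_normE /ball_/= rnormE ltcR.
have coordF i : cvg ((fun f : ell2 I H => f i) @ F).
  apply: cauchy_cvg; apply/cauchy_ballP => e /posC[r r0 re].
  have [A FA AA] := cauF _ r0.
  pose B : set H := [set f i | f in A].
  have FB : (f i @[f --> F]) B.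
    by apply: (@filterS _ F _ A) => // f Af; exists f.
  exists (B, B) => //= -[_ _] /= [[f Af <-] [g Ag <-]].
  rewrite -ball_normE /ball_/= rnormE -re ltcR.
  exact: le_lt_trans (ell2_coord_le (f - g) i) (AA _ _ Af Ag).
pose l i := lim ((fun f : ell2 I H => f i) @ F).
have sumF (f : ell2 I H) (s : seq I) :
    (fun g : ell2 I H => \sum_(i <- s) rnorm (f i - g i) ^+ 2) @ F -->
    \sum_(i <- s) rnorm (f i - l i) ^+ 2.
  elim: s => [|i s IH].
    rewrite big_nil; under eq_fun do rewrite big_nil; exact: cvg_cst.
  rewrite big_cons; under eq_fun do rewrite big_cons.
  have c : (fun g : ell2 I H => rnorm (f i - g i)) @ F --> rnorm (f i - l i).
    exact: rnorm_cvg.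
  exact: (cvgD (cvgM c c) IH).
have bndF (e : R) : 0 < e -> exists2 A, F A & forall f, A f -> forall J : {fset I},
    \sum_(i <- J) rnorm (f i - l i) ^+ 2 <= e ^+ 2.
  move=> e0; have [A FA AA] := cauF _ e0; exists A => // f Af J.
  have c := sumF f J; rewrite -(cvg_lim (@Rhausdorff R) c).
  apply: limr_le; first by apply/cvg_ex; eexists; exact: c.
  apply: filterS FA => g Ag.
  rewrite (le_trans (ell2_normsq_ge (f - g) J))// -ell2_rnorm_sqr.
  by rewrite ler_pXn2r// ?nnegrE ?rnorm_ge0 ?(ltW e0)// ltW// AA.
have sq0 (u : I -> H) i : 0 <= rnorm (u i) ^+ 2 by rewrite sqr_ge0.
have [A FA AA] := bndF 1 ltr01.
have [f0 Af0] := filter_ex FA.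
have dP : (fun i => f0 i - l i) \in @ell2_pred R I H.
  apply/asboolP/rsummable_nn; first exact: sq0.
  by apply: le_lt_trans (nnsum_le (AA _ Af0)) (ltry _).
pose L := f0 - Ell2 dP.
have LE i : L i = l i by rewrite /L ell2DE ell2NE /= subKr.
apply/cvg_ex; exists L; apply/cvgrPdist_le => e /posC[r r0 <-].
have [B FB BB] := bndF _ r0; apply: filterS FB => f Bf.
rewrite rnormE lecR -rnormN opprB -(ler_pXn2r (n := 2))// ?nnegrE ?rnorm_ge0 ?(ltW r0)//.
rewrite ell2_rnorm_sqr; apply: ell2_normsq_le => J.
under eq_bigr do rewrite ell2DE ell2NE LE.
exact: BB.
Qed.

HB.instance Definition _ := Uniform_isComplete.Build (ell2 I H) ell2_complete.
HB.instance Definition _ := isHilbert.Build R (ell2 I H)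
  ell2_inner_linearl ell2_inner_conj ell2_inner_norm.

End Ell2Complete.

Section BoundedOperators.
Context {R : realType}.

Section Def.
Context (H K : hilbertType R).

Definition bounded_pred : {pred H -> K} :=
  [pred T | `[< linear T /\
                exists M : R, forall x, rnorm (T x) <= M * rnorm x >]].

Record bop := Bop { bop_fun :> H -> K ; _ : bop_fun \in bounded_pred }.

HB.instance Definition _ := [isSub of bop for bop_fun].
HB.instance Definition _ := [Choice of bop by <:].

Let bounded_submod_closed : submod_closed bounded_pred.
Proof.
split=> [|a S T /asboolP[lS [M SM]] /asboolP[lT [N TN]]]; apply/asboolP; split.
- by move=> b x y /=; rewrite scaler0 addr0.
- by exists 0 => x; rewrite mul0r /rnorm normr0.
- move=> b x y; rewrite -![(a *: S + T) _]/(a *: S _ + T _) lS lT !scalerDr.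
  by rewrite !scalerA [a * b]mulrC addrACA.
- exists (complex.Re `|a| * M + N) => x; rewrite (le_trans (rnormD _ _))//.
  have a0 : 0 <= complex.Re `|a|.
    by rewrite -ler0c RRe_real ?normr_ge0// normr_real.
  by rewrite mulrDl lerD// rnormZ -mulrA ler_wpM2l.
Qed.

HB.instance Definition _ := GRing.isSubmodClosed.Build R[i] (H -> K) bounded_pred
  bounded_submod_closed.
HB.instance Definition _ := [SubChoice_isSubLmodule of bop by <:].

Lemma bop_linear (T : bop) : linear T.
Proof. by case: T => T /= /asboolP[]. Qed.

HB.instance Definition _ (T : bop) :=
  GRing.isLinear.Build R[i] H K *:%R T (bop_linear T).

Lemma bop_bounded (T : bop) :
  exists2 M : R, 0 <= M & forall x, rnorm (T x) <= M * rnorm x.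
Proof.
case: T => T /= /asboolP[_ [M TM]]; exists `|M| => // x.
by rewrite (le_trans (TM x))// ler_wpM2r ?rnorm_ge0// ler_norm.
Qed.

Lemma bop_eqP (S T : bop) : (forall x, S x = T x) -> S = T.
Proof. by move=> ST; apply/val_inj/funext. Qed.

Lemma bopDE (S T : bop) x : (S + T) x = S x + T x. Proof. by []. Qed.
Lemma bopZE (a : R[i]) (T : bop) x : (a *: T) x = a *: T x. Proof. by []. Qed.
Lemma bopNE (T : bop) x : (- T) x = - T x. Proof. by []. Qed.

Definition opnorm (T : bop) : R :=
  sup [set rnorm (T x) | x in [set x | rnorm x <= 1]].

End Def.

Lemma bop_comp_subproof (H K L : hilbertType R) (S : bop K L) (T : bop H K) :
  S \o T \in @bounded_pred H L.
Proof.
apply/asboolP; split; first by move=> a x y /=; rewrite !linearP.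
have [M M0 SM] := bop_bounded S; have [N N0 TN] := bop_bounded T.
exists (M * N) => x /=; rewrite (le_trans (SM _))// -mulrA.
by rewrite ler_wpM2l.
Qed.

Definition bop_comp (H K L : hilbertType R) (S : bop K L) (T : bop H K) :
    bop H L :=
  Bop (bop_comp_subproof S T).

Lemma bop_id_subproof (H : hilbertType R) : @idfun H \in @bounded_pred H H.
Proof. by apply/asboolP; split => //; exists 1 => x; rewrite mul1r. Qed.

Definition bop_id (H : hilbertType R) : bop H H := Bop (bop_id_subproof H).

Section Ring.
Variable H : hilbertType R.

Let compA : associative (@bop_comp H H H).
Proof. by move=> S T U; exact: bop_eqP. Qed.
Let comp1l : left_id (bop_id H) (@bop_comp H H H).
Proof. by move=> T; exact: bop_eqP. Qed.
Let comp1r : right_id (bop_id H) (@bop_comp H H H).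
Proof. by move=> T; exact: bop_eqP. Qed.
Let compDl : left_distributive (@bop_comp H H H) +%R.
Proof. by move=> S T U; exact: bop_eqP. Qed.
Let compDr : right_distributive (@bop_comp H H H) +%R.
Proof. by move=> S T U; apply: bop_eqP => x; rewrite /= linearD. Qed.

HB.instance Definition _ := GRing.Zmodule_isPzRing.Build (bop H H)
  compA comp1l comp1r compDl compDr.

Lemma bopME (S T : bop H H) x : (S * T) x = S (T x). Proof. by []. Qed.
Lemma bop1E x : (1 : bop H H) x = x. Proof. by []. Qed.

End Ring.

End BoundedOperators.

Notation "''B' ( H )" := (bop H H) (format "''B' ( H )") : type_scope.

Section OperatorAlgebras.
Context {R : realType}.
Implicit Types H K : hilbertType R.

(* As every bounded operator on a Hilbert space has exactly one adjoint,
   conditions on adjoints are stated for all S with [is_adjoint T S]. *)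
Definition is_adjoint H (T S : 'B(H)) : Prop :=
  forall x y, inner (T x) y = inner x (S y).

Definition star_closed H (E : set 'B(H)) : Prop :=
  forall T S, E T -> is_adjoint T S -> E S.

Definition subspace (V : lmodType R[i]) (E : set V) : Prop :=
  E 0 /\ forall (a : R[i]) S T, E S -> E T -> E (a *: S + T).

Definition lspan (V : lmodType R[i]) (E : set V) : set V :=
  [set T | exists n (c : 'I_n -> R[i]) (S : 'I_n -> V),
    (forall i, E (S i)) /\ T = \sum_i c i *: S i].

(* The ultra-weak topology is the one induced by the functionals
   [uw_functional xi eta], xi and eta ranging over the square-summable
   sequences of vectors. *)
Definition uw_functional H (xi eta : ell2 nat H) (T : 'B(H)) : R[i] :=
  csum (fun n => inner (T (xi n)) (eta n)).

Definition uw_closure H (E : set 'B(H)) : set 'B(H) :=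
  [set T | forall n (xi eta : 'I_n -> ell2 nat H) (e : R), 0 < e ->
    exists2 S, E S &
      forall k, `|uw_functional (xi k) (eta k) (S - T)| < e%:C].

Record von_neumann_algebra H (A : set 'B(H)) : Prop := {
  vn_one : A 1 ;
  vn_subspace : subspace A ;
  vn_mul : forall S T, A S -> A T -> A (S * T) ;
  vn_star : star_closed A ;
  vn_closed : uw_closure A `<=` A
}.

Definition operator_mx_ge0 H n (M : 'M['B(H)]_n) : Prop :=
  forall v : 'I_n -> H, 0 <= \sum_i \sum_j inner (M i j (v j)) (v i).

Definition linear_on H K (E : set 'B(K)) (phi : 'B(K) -> 'B(H)) : Prop :=
  forall (a : R[i]) S T, E S -> E T -> phi (a *: S + T) = a *: phi S + phi T.

Definition completely_positive_on H K (E : set 'B(K))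
    (phi : 'B(K) -> 'B(H)) : Prop :=
  forall n (M : 'M['B(K)]_n), (forall i j, E (M i j)) ->
    operator_mx_ge0 M -> operator_mx_ge0 (map_mx phi M).

Definition operator_system H (E : set 'B(H)) : Prop :=
  [/\ E 1, subspace E & star_closed E].

(* Injectivity as an object of the category of operator systems and completely
   positive maps. A map defined on E is represented by a total function of
   which only the restriction to E is used. *)
Definition injective_algebra H (A : set 'B(H)) : Prop :=
  forall K (E F : set 'B(K)) (phi : 'B(K) -> 'B(H)),
    operator_system E -> operator_system F -> E `<=` F ->
    linear_on E phi -> completely_positive_on E phi -> phi @` E `<=` A ->
    exists psi : 'B(K) -> 'B(H),
      [/\ linear_on F psi, completely_positive_on F psi, psi @` F `<=` A &
          forall T, E T -> psi T = phi T].

Definition star_automorphism H (A : set 'B(H)) (f : 'B(H) -> 'B(H)) : Prop :=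
  [/\ set_bij A A f, linear_on A f,
      forall S T, A S -> A T -> f (S * T) = f S * f T &
      forall S T, A S -> A T -> is_adjoint S T -> is_adjoint (f S) (f T)].

Definition star_action H (G : groupType) (A : set 'B(H))
    (alpha : G -> 'B(H) -> 'B(H)) : Prop :=
  [/\ forall g, star_automorphism A (alpha g),
      forall T, A T -> alpha 1%g T = T &
      forall g h T, A T -> alpha (g * h)%g T = alpha g (alpha h T)].

End OperatorAlgebras.

(* H \otimes l_2(G) is realized as [ell2 G H], the elementary tensor
   x \otimes delta_h being the family with value x at h and 0 elsewhere. *)
Section BlockOperators.
Context {R : realType} {I : choiceType} {H : hilbertType R}.

Let tens_delta_fun (h : I) (x : H) (k : I) : H := if k == h then x else 0.

Let tens_delta_le (h : I) (x : H) (J : {fset I}) :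
  \sum_(k <- J) rnorm (tens_delta_fun h x k) ^+ 2 <= rnorm x ^+ 2.
Proof.
have r0 : rnorm (0 : H) ^+ 2 = 0 by rewrite /rnorm normr0 expr0n.
have E k : rnorm (tens_delta_fun h x k) ^+ 2 =
    if k == h then rnorm x ^+ 2 else 0.
  by rewrite /tens_delta_fun; case: ifP.
under eq_bigr do rewrite E.
have [hJ|hJ] := boolP (h \in J).
  rewrite (bigD1_seq h)//= eqxx big1 ?addr0//.
  by move=> k /negbTE ->.
rewrite big1_seq ?sqr_ge0// => k /andP[_ kJ].
by case: eqP kJ => // ->; rewrite (negbTE hJ).
Qed.

Let tens_delta_subproof (h : I) (x : H) : tens_delta_fun h x \in @ell2_pred R I H.
Proof.
apply/asboolP/rsummable_nn; first by move=> k; rewrite sqr_ge0.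
exact: le_lt_trans (nnsum_le (tens_delta_le h x)) (ltry _).
Qed.

Definition tens_delta_vec (h : I) (x : H) : ell2 I H :=
  Ell2 (tens_delta_subproof h x).

Let tens_delta_bounded (h : I) : tens_delta_vec h \in @bounded_pred R H (ell2 I H).
Proof.
apply/asboolP; split.
  move=> a x y; apply: ell2_eqP => k; rewrite ell2DE ell2ZE /= /tens_delta_fun.
  by case: ifP => // _; rewrite scaler0 addr0.
exists 1 => x; rewrite mul1r -(ler_pXn2r (n := 2))// ?nnegrE ?rnorm_ge0//.
rewrite ell2_rnorm_sqr; apply: ell2_normsq_le => J; exact: tens_delta_le.
Qed.

Definition tens_delta (h : I) : bop H (ell2 I H) := Bop (tens_delta_bounded h).

Lemma tens_deltaE h x k : tens_delta h x k = if k == h then x else 0.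
Proof. by []. Qed.

Let coord_bounded (g : I) : (fun f : ell2 I H => f g) \in @bounded_pred R (ell2 I H) H.
Proof.
apply/asboolP; split; first by [].
by exists 1 => f; rewrite mul1r ell2_coord_le.
Qed.

Definition coord (g : I) : bop (ell2 I H) H := Bop (coord_bounded g).

Definition block (x : 'B(ell2 I H)) (g h : I) : 'B(H) :=
  bop_comp (coord g) (bop_comp x (tens_delta h)).

Lemma blockE x g h v : block x g h v = x (tens_delta h v) g.
Proof. by []. Qed.

(* The bounded operator \sum_g d g \otimes e_(g,g), if the family d is
   uniformly bounded, and 0 otherwise. *)
Definition diag_op (d : I -> 'B(H)) : 'B(ell2 I H) :=
  xget 0 [set T : 'B(ell2 I H) | forall f g, T f g = d g (f g)].

Lemma diag_opE (d : I -> 'B(H)) (M : R) :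
  (forall g x, rnorm (d g x) <= M * rnorm x) ->
  forall f g, diag_op d f g = d g (f g).
Proof.
move=> dM; have {dM}[N N0 dN] : exists2 N : R, 0 <= N &
    forall g x, rnorm (d g x) <= N * rnorm x.
  exists `|M| => // g x.
  by rewrite (le_trans (dM g x))// ler_wpM2r ?rnorm_ge0// ler_norm.
have le2 (f : ell2 I H) (J : {fset I}) :
    \sum_(g <- J) rnorm (d g (f g)) ^+ 2 <= N ^+ 2 * ell2_normsq f.
  apply: (@le_trans _ _ (\sum_(g <- J) N ^+ 2 * rnorm (f g) ^+ 2)).
    apply: ler_sum => g _; rewrite -exprMn.
    by rewrite ler_pXn2r// ?nnegrE ?mulr_ge0 ?rnorm_ge0.
  by rewrite -mulr_sumr ler_wpM2l ?sqr_ge0// ell2_normsq_ge.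
have dP (f : ell2 I H) : (fun g => d g (f g)) \in @ell2_pred R I H.
  apply/asboolP/rsummable_nn; first by move=> g; rewrite sqr_ge0.
  exact: le_lt_trans (nnsum_le (le2 f)) (ltry _).
pose D (f : ell2 I H) : ell2 I H := Ell2 (dP f).
have Dbd : D \in @bounded_pred R (ell2 I H) (ell2 I H).
  apply/asboolP; split.
    by move=> a f h; apply: ell2_eqP => g; rewrite ell2DE ell2ZE /= linearP.
  exists N => f; rewrite -(ler_pXn2r (n := 2))// ?nnegrE ?mulr_ge0 ?rnorm_ge0//.
  by rewrite exprMn !ell2_rnorm_sqr; apply: ell2_normsq_le => J; exact: le2.
have : [set T : 'B(ell2 I H) | forall f g, T f g = d g (f g)] (diag_op d).
  by apply: xgetPex; exists (Bop Dbd).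
by [].
Qed.

Definition Diag (x : 'B(ell2 I H)) : 'B(ell2 I H) :=
  diag_op (fun g => block x g g).

Lemma DiagE x f g : Diag x f g = x (tens_delta g (f g)) g.
Proof.
have [M M0 xM] := bop_bounded x.
rewrite (@diag_opE _ M)// => {f}g v; rewrite blockE.
rewrite (le_trans (ell2_coord_le _ _))// (le_trans (xM _))// ler_wpM2l//.
rewrite -(ler_pXn2r (n := 2))// ?nnegrE ?rnorm_ge0//.
rewrite ell2_rnorm_sqr; apply: ell2_normsq_le => J; exact: tens_delta_le.
Qed.

End BlockOperators.

Section CrossedProduct.
Context {R : realType} {H : hilbertType R} {G : groupType}.
Implicit Types (g h : G) (A : set 'B(H)) (alpha : G -> 'B(H) -> 'B(H)).

Let shift_le g (f : ell2 G H) (J : {fset G}) :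
  \sum_(h <- J) rnorm (f (g^-1 * h)%g) ^+ 2 <= ell2_normsq f.
Proof.
pose J' := [fset (g^-1 * h)%g | h in J]%fset.
rewrite (_ : \sum_(h <- J) _ = \sum_(k <- J') rnorm (f k) ^+ 2).
  exact: ell2_normsq_ge.
by rewrite big_imfset//= => x y _ _; exact: mulgI.
Qed.

Let shift_subproof g (f : ell2 G H) :
  (fun h => f (g^-1 * h)%g) \in @ell2_pred R G H.
Proof.
apply/asboolP/rsummable_nn; first by move=> h; rewrite sqr_ge0.
exact: le_lt_trans (nnsum_le (shift_le g f)) (ltry _).
Qed.

Let shift g (f : ell2 G H) : ell2 G H := Ell2 (shift_subproof g f).

Let shift_bounded g : shift g \in @bounded_pred R (ell2 G H) (ell2 G H).
Proof.
apply/asboolP; split; first by move=> a f1 f2; exact: ell2_eqP.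
exists 1 => f; rewrite mul1r -(ler_pXn2r (n := 2))// ?nnegrE ?rnorm_ge0//.
by rewrite !ell2_rnorm_sqr; apply: ell2_normsq_le => J; exact: shift_le.
Qed.

(* L_g = I_H \otimes lambda_g, cf. translation_tens_delta. *)
Definition translation g : 'B(ell2 G H) := Bop (shift_bounded g).

Lemma translationE g f h : translation g f h = f (g^-1 * h)%g.
Proof. by []. Qed.

Lemma translation_tens_delta g h (x : H) :
  translation g (tens_delta h x) = tens_delta (g * h)%g x.
Proof.
apply: ell2_eqP => k; rewrite translationE !tens_deltaE.
by rewrite -(inj_eq (mulgI g)) mulVKg.
Qed.

(* The family (alpha g^-1 r)_g is bounded because *-automorphisms are
   isometric, so diag_op does not take its default value here. *)
Definition Psi alpha (r : 'B(H)) : 'B(ell2 G H) :=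
  diag_op (fun g => alpha g^-1%g r).

Definition crossed_product A alpha : set 'B(ell2 G H) :=
  uw_closure (lspan [set translation g * Psi alpha r | g in setT & r in A]).

Definition positive_definite (chi : G -> R) : Prop :=
  forall n (g : 'I_n -> G) (c : 'I_n -> R[i]),
    0 <= \sum_i \sum_j (c i)^* * c j * (chi ((g i)^-1 * g j)%g)%:C.

Record unbounded_expectation A alpha (chi : G -> R)
    (sigma : 'B(ell2 G H) -> 'B(ell2 G H)) : Prop := {
  ue_range : forall x, crossed_product A alpha (sigma x) ;
  ue_linear : linear sigma ;
  ue_unital : sigma 1 = 1 ;
  ue_cp : completely_positive_on setT sigma ;
  ue_bimodular : forall r s x, A r -> A s ->
    sigma (Psi alpha r * x * Psi alpha s) = Psi alpha r * sigma x * Psi alpha s ;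
  ue_positive_definite : positive_definite chi ;
  ue_strictly_positive : forall g, 0 < chi g ;
  ue_fourier : forall g r, A r ->
    sigma (translation g * Psi alpha r) =
    (chi g)%:C *: (translation g * Psi alpha r) ;
  ue_diag : forall x g,
    opnorm (Diag (translation g^-1%g * sigma x)) <= chi g * opnorm x
}.

End CrossedProduct.

(* Main.v *)
Require Import Defs.
From HB Require Import structures.
From mathcomp Require Import all_boot all_order all_algebra.
From mathcomp Require Import complex ring lra finmap.
From mathcomp Require Import boolp classical_sets functions cardinality fsbigop.
From mathcomp Require Import reals ereal topology normedtype sequences esum numfun.

Set Implicit Arguments.
Unset Strict Implicit.
Unset Printing Implicit Defensive.

Import Order.TTheory GRing.Theory Num.Theory.
Import numFieldNormedType.Exports.

Local Open Scope classical_set_scope.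
Local Open Scope ring_scope.
Local Open Scope complex_scope.

(** Injectivity of A extends the identity of A to a unital completely positive
    map E from B(H) to A, and such a map is automatically an A-bimodule map.
    It need not commute with the action, and in general G has no invariant mean
    to repair this. What is available is averaging with weights: if f is a
    strictly positive summable function on G with sum of squares 1, put

      sigma x = sum_(s, t) f s * f t * L_s Psi (E x_(s, t)) L_t^-1,

    where x_(s, t) are the blocks of x. The series converges absolutely in
    norm, so that sigma x is a norm limit, hence an ultra-weak limit, of linear
    combinations of the operators L_g Psi r.

    The block of L_g Psi r at (s, t) is alpha_t^-1 r if s = g t and 0
    otherwise, and the covariance relation L_t Psi a = Psi (alpha_t a) L_t
    turns L_(g t) Psi (alpha_t^-1 r) L_t^-1 back into L_g Psi r. Hence sigma
    multiplies L_g Psi r by chi g = sum_t f (g t) * f t, a coefficient of the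
    regular representation: chi is positive definite, and it is strictly
    positive because f is. In the same way only the terms with s = g t meet the
    diagonal of L_g^-1 sigma x; each of them has norm at most that of x, so the
    diagonal is bounded by chi g times the norm of x. Complete positivity holds
    because sigma has the form sum_(s, t) V_s^* rho (x_(s, t)) V_t with
    rho = Psi o E, and bimodularity comes from that of E together with
    covariance.

    For f, the countable group G is enumerated by e : nat -> G, possibly with
    repetitions, and e n receives the mass 2^-(n+1); repeated masses add up.
    All sums are then over pairs of natural numbers, with partial sums over
    squares, and the normalisation sum f^2 = 1 is replaced by a final division
    by chi 1.

    Three facts on operator algebras carry this. First, unital *-homomorphisms
    on A are completely positive (star_hom_cp): X + t is invertible inside the
    algebra for X >= 0 and t > 0 by the Neumann series, invertibility is
    preserved by the homomorphism, and a self-adjoint b such that all b + t,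
    t > 0, are invertible is positive. This applies to the automorphisms
    alpha_g and to Psi. Secondly, unital completely positive maps preserve
    adjoints and are contractive (ucp_adjoint, ucp_contractive), by looking at
    2 x 2 matrices. Thirdly, they are bimodular over an algebra which they fix
    (ucp_mull, ucp_mulr). Adjoints come from the Riesz representation
    theorem. *)

(** * Inner products and completeness *)

Section InnerProduct.
Context {R : realType} {H : hilbertType R}.
Implicit Types x y z : H.

Lemma rnorm0 : rnorm (0 : H) = 0.
Proof. by rewrite /rnorm normr0. Qed.

Lemma rnorm_eq0 x : rnorm x = 0 -> x = 0.
Proof. by move=> h; apply/eqP; rewrite -normr_eq0 rnormE h. Qed.

Lemma rnormZr (a : R) x : rnorm (a%:C *: x) = `|a| * rnorm x.
Proof. by rewrite rnormZ /= expr0n addr0 sqrtr_sqr. Qed.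

Lemma rnormB x y : rnorm (x - y) = rnorm (y - x).
Proof. by rewrite -rnormN opprB. Qed.

Lemma innerNl x y : inner (- x) y = - inner x y.
Proof. by rewrite -scaleN1r innerZl mulN1r. Qed.

Lemma innerBl x y z : inner (x - y) z = inner x z - inner y z.
Proof. by rewrite innerDl innerNl. Qed.

Lemma innerBr x y z : inner z (x - y) = inner z x - inner z y.
Proof. by rewrite innerDr innerNr. Qed.

Lemma inner0r x : inner x 0 = 0.
Proof. by rewrite inner_conj inner0l conjc0. Qed.

Lemma inner_suml (I : Type) (r : seq I) (P : pred I) (F : I -> H) y :
  inner (\sum_(i <- r | P i) F i) y = \sum_(i <- r | P i) inner (F i) y.
Proof. by apply: (big_morph (inner^~ y) (fun x z => innerDl x z y) (inner0l y)). Qed.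

Lemma inner_sumr (I : Type) (r : seq I) (P : pred I) (F : I -> H) y :
  inner y (\sum_(i <- r | P i) F i) = \sum_(i <- r | P i) inner y (F i).
Proof. by apply: (big_morph (inner y) (fun x z => innerDr x z y) (inner0r y)). Qed.

Lemma Re_inner_sym x y : complex.Re (inner x y) = complex.Re (inner y x).
Proof. by rewrite [inner y x]inner_conj; case: (inner x y). Qed.

Lemma Re_innerZr (a : R) x y : complex.Re (inner x (a%:C *: y)) = a * complex.Re (inner x y).
Proof. by rewrite innerZr; case: (inner x y) => b c /=; rewrite oppr0 mul0r subr0. Qed.

Lemma Re_innerZl (a : R) x y : complex.Re (inner (a%:C *: x) y) = a * complex.Re (inner x y).
Proof. by rewrite Re_inner_sym Re_innerZr Re_inner_sym. Qed.

Lemma inner_inj x y : (forall z, inner x z = inner y z) -> x = y.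
Proof.
move=> h; apply/eqP; rewrite -subr_eq0; apply/eqP/rnorm_eq0/eqP.
rewrite -sqrf_eq0 -(inj_eq (@complexI R)) -inner_rnormE innerBl h.
by rewrite subrr.
Qed.

Lemma Re_inner_CS x y : complex.Re (inner x y) <= rnorm x * rnorm y.
Proof.
have [/rnorm_eq0 ->|x0] := eqVneq (rnorm x) 0; first by rewrite inner0l rnorm0 mul0r.
have [/rnorm_eq0 ->|y0] := eqVneq (rnorm y) 0; first by rewrite inner0r rnorm0 mulr0.
have xy0 : 0 < rnorm x * rnorm y by rewrite mulr_gt0// lt_neqAle eq_sym ?x0 ?y0 rnorm_ge0.
have := sqr_ge0 (rnorm ((rnorm y)%:C *: x - (rnorm x)%:C *: y)).
rewrite rnorm_sqrD rnormN !rnormZr !ger0_norm ?rnorm_ge0// -scaleNr -rmorphN/=.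
rewrite Re_innerZr Re_innerZl => h; rewrite -(ler_pM2l xy0); move: h.
move: (rnorm x) (rnorm y) (complex.Re _) => a b c; lra.
Qed.

Lemma normcE (c : R[i]) : `|c| = (complex.Re `|c|)%:C.
Proof. by rewrite RRe_real// normr_real. Qed.

Lemma normcJ (c : R[i]) : `|c^*| = `|c|.
Proof. by case: c => a b; rewrite !normc_def /= sqrrN. Qed.

(** Multiplying x by the conjugate of the inner product makes it real, which
    reduces the complex inequality to the one for real parts. *)
Lemma inner_CS x y : `|inner x y| <= (rnorm x * rnorm y)%:C.
Proof.
have [->|c0] := eqVneq (inner x y) 0; first by rewrite normr0 ler0c mulr_ge0 ?rnorm_ge0.
set c := inner x y in c0 *.
have := Re_inner_CS (c^* *: x) y.
have -> : inner (c^* *: x) y = (complex.Re `|c| ^+ 2)%:C.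
  by rewrite innerZl -/c mulrC -normCK rmorphXn /= -normcE.
rewrite rnormZ normcJ.
have : 0 < `|c| by rewrite normr_gt0.
move: (`|c|) (normcE c) => d -> ; rewrite ltcR lecR /= => d0.
by rewrite -mulrA expr2 ler_pM2l.
Qed.

Lemma rnorm_sqr_inner x : rnorm x ^+ 2 = complex.Re (inner x x).
Proof. by rewrite inner_rnormE. Qed.

(** The bound r serves at the same time as modulus of the Cauchy property and
    as rate of convergence; with an explicit rate, limits of operators can be
    handled by real sequences alone. *)
Lemma rnorm_cvg_ex (u : nat -> H) (r : nat -> R) :
  (forall M N, (M <= N)%N -> rnorm (u N - u M) <= r M) ->
  r @ \oo --> 0 ->
  exists l, forall M, rnorm (l - u M) <= r M.
Proof.
move=> ur r0.
have r0' (e : R) : 0 < e -> exists N, forall n, (N <= n)%N -> r n < e.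
  move=> e0; move/cvgrPdist_lt : r0 => /(_ _ e0)[N _ hN]; exists N => n Nn.
  by have := hN n Nn; rewrite sub0r normrN; apply: le_lt_trans; rewrite ler_norm.
have cu : cvg (u @ \oo).
  apply: cauchy_cvg; apply/cauchy_ballP => e e0.
  have eE : (complex.Re e)%:C = e by rewrite RRe_real// gtr0_real.
  have [N hN] : exists N, forall n, (N <= n)%N -> r n < complex.Re e / 2.
    by apply: r0'; rewrite divr_gt0// -ltcR eE.
  pose B : set H := [set u n | n in [set n | (N <= n)%N]].
  have FB : (u @ \oo) B by exists N => // n Nn; exists n.
  exists (B, B) => //= -[_ _] /= [[n Nn <-] [m Nm <-]].
  rewrite -ball_normE /ball_/= rnormE -eE ltcR.
  wlog nm : n m Nn Nm / (n <= m)%N.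
    move=> W; have [nm|/ltnW mn] := leqP n m; first exact: W.
    by rewrite rnormB; exact: W.
  rewrite rnormB (le_lt_trans (ur _ _ nm))// (lt_le_trans (hN _ Nn))//.
  have : 0 < complex.Re e by rewrite -ltcR eE.
  by move=> ?; lra.
exists (lim (u @ \oo)) => M; apply/ler_addgt0Pr => e e0.
have e0C : 0 < e%:C :> R[i] by rewrite ltcR.
move/cvgrPdist_lt : cu => /(_ _ e0C)[N _ hN].
have := hN (maxn M N) (leq_maxr _ _); rewrite rnormE ltcR => /ltW h.
have h' := ur _ _ (leq_maxl M N).
set l := lim _ in h *.
have -> : l - u M = (l - u (maxn M N)) + (u (maxn M N) - u M) by rewrite addrA subrK.
by rewrite (le_trans (rnormD _ _))// addrC lerD.
Qed.
End InnerProduct.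

(** * Riesz representation and adjoints *)

Section Riesz.
Context {R : realType} {H : hilbertType R}.
Implicit Types x y z : H.

(** The discriminant of a quadratic polynomial that stays nonnegative. *)
Lemma quadratic_ge0 (a b c : R) : 0 <= c ->
  (forall s, 0 <= a + 2 * s * b + s ^+ 2 * c) -> b ^+ 2 <= a * c.
Proof.
rewrite le_eqVlt => /orP[/eqP <-|c0] h.
  have [->|b0] := eqVneq b 0; first by rewrite expr0n mulr0.
  have := h (- (a + 1) / (2 * b)).
  have -> : 2 * (- (a + 1) / (2 * b)) * b = - (a + 1) by field.
  by rewrite mulr0; move=> ?; lra.
have := h (- b / c).
have -> : a + 2 * (- b / c) * b + (- b / c) ^+ 2 * c = (a * c - b ^+ 2) / c.
  by field; rewrite gt_eqF.
by rewrite pmulr_lge0 ?invr_gt0// subr_ge0.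
Qed.

Lemma geometric_cvg0 (C q : R) : `|q| < 1 -> (fun n => C * q ^+ n) @ \oo --> 0.
Proof. by move=> /cvg_expr h; rewrite -(mulr0 C); apply: cvgM; [exact: cvg_cst|exact: h]. Qed.

Lemma le_cvg0 (a : R) (r : nat -> R) : (forall n, a <= r n) -> r @ \oo --> 0 -> a <= 0.
Proof.
move=> ar r0; rewrite -(cvg_lim (@Rhausdorff R) r0).
by apply: limr_ge; [apply/cvg_ex; exists 0|exact: nearW].
Qed.

Lemma rnorm_sqrB x y :
  rnorm (x - y) ^+ 2 = rnorm x ^+ 2 + rnorm y ^+ 2 - 2 * complex.Re (inner x y).
Proof. by rewrite rnorm_sqrD rnormN innerNr raddfN/= mulrN. Qed.

(** The representing vector minimizes the strictly convex functional
    Phi x = |x|^2 - 2 Re (f x). A minimizing sequence is Cauchy by the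
    parallelogram law, and the derivative 2 Re <., l> - 2 Re f of Phi vanishes
    at its limit l. *)
Lemma riesz (f : H -> R[i]) (C : R) :
  (forall a x y, f (a *: x + y) = a * f x + f y) ->
  (forall x, complex.Re (f x) <= C * rnorm x) ->
  exists y, forall x, f x = inner x y.
Proof.
move=> flin fC.
have fD x y : f (x + y) = f x + f y by rewrite -{1}[x]scale1r flin mul1r.
have f0 : f 0 = 0 by apply: (addrI (f 0)); rewrite -fD !addr0.
have fZ a x : f (a *: x) = a * f x by rewrite -[a *: x]addr0 flin f0 addr0.
have fN x : f (- x) = - f x by rewrite -scaleN1r fZ mulN1r.
have fZr (a : R) x : complex.Re (f (a%:C *: x)) = a * complex.Re (f x).
  by rewrite fZ; case: (f x) => b c /=; rewrite mul0r subr0.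
pose Phi x := rnorm x ^+ 2 - 2 * complex.Re (f x).
have Phi_ge x : - C ^+ 2 <= Phi x.
  have := fC x; have := sqr_ge0 (rnorm x - C); rewrite /Phi; nra.
have Phi_inf : has_inf (range Phi).
  by split; [exists (Phi 0), 0|exists (- C ^+ 2) => _ [x _ <-]].
pose m := inf (range Phi).
have mPhi x : m <= Phi x by apply: ge_inf; [case: Phi_inf|exists x].
pose eps n : R := 2^-1 ^+ n.
have eps0 n : 0 < eps n by rewrite exprn_gt0// invr_gt0.
have /choice[u uP] n : exists x, Phi x <= m + eps n ^+ 2.
  have e0 : 0 < eps n ^+ 2 by rewrite exprn_gt0.
  by have [_ [x _ <-] /ltW xP] := inf_adherent e0 Phi_inf; exists x.
have epsM M N : (M <= N)%N -> eps N <= eps M.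
  by move=> MN; rewrite ler_wiXn2l// ?invr_ge0// invf_le1// ler1n.
have half : `|2^-1 : R| < 1 by rewrite ger0_norm ?invr_ge0// invf_lt1// ltr1n.
have ucau M N : (M <= N)%N -> rnorm (u N - u M) <= 2 * eps M.
  move=> MN; rewrite -(ler_pXn2r (n := 2))// ?nnegrE ?rnorm_ge0 ?mulr_ge0 ?(ltW (eps0 _))//.
  have : eps N ^+ 2 <= eps M ^+ 2.
    by rewrite ler_pXn2r// ?nnegrE ?(ltW (eps0 _))// epsM.
  have := mPhi ((2^-1)%:C *: (u N + u M)).
  have := uP N; have := uP M; rewrite rnorm_sqrB /Phi.
  rewrite rnormZr fZr exprMn rnorm_sqrD fD raddfD/= ger0_norm ?invr_ge0//.
  rewrite exprMn => *; lra.
have [l lP] := rnorm_cvg_ex ucau (geometric_cvg0 2 half).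
exists l => z.
(* Half the derivative of Phi at u n is at most eps n in norm, because
   Phi (u n) is within (eps n)^2 of the infimum. *)
have key w : complex.Re (f w) = complex.Re (inner w l).
  apply/eqP; rewrite -subr_eq0 -normr_eq0 eq_le normr_ge0 andbT.
  apply: (@le_cvg0 _ (fun n => 3 * rnorm w * eps n)); last exact: geometric_cvg0.
  move=> n.
  have h1 : `|complex.Re (f w) - complex.Re (inner w (u n))| <= eps n * rnorm w.
    rewrite -(ler_pXn2r (n := 2))// ?nnegrE ?mulr_ge0 ?rnorm_ge0 ?(ltW (eps0 _))//.
    rewrite real_normK ?num_real// exprMn; apply: quadratic_ge0; first by rewrite sqr_ge0.
    move=> s; have := mPhi (u n - s%:C *: w); have := uP n.
    rewrite /Phi rnorm_sqrB fD fN raddfB/= fZr Re_innerZr rnormZr.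
    rewrite exprMn real_normK ?num_real// (Re_inner_sym (u n)) => *; lra.
  have h2 : `|complex.Re (inner w (u n)) - complex.Re (inner w l)| <= rnorm w * (2 * eps n).
    rewrite -raddfB/= -innerBr ler_norml.
    have := Re_inner_CS w (u n - l); have := Re_inner_CS w (l - u n).
    rewrite -(opprB (u n)) innerNr raddfN rnormN/= => a1 a2.
    have : rnorm w * rnorm (u n - l) <= rnorm w * (2 * eps n).
      by rewrite ler_wpM2l ?rnorm_ge0// rnormB.
    by move=> ?; apply/andP; split; lra.
  have := ler_normD (complex.Re (f w) - complex.Re (inner w (u n)))
    (complex.Re (inner w (u n)) - complex.Re (inner w l)).
  rewrite addrA subrK; nra.
(* Evaluating at 'i *: z compares the imaginary parts. *)
have := key ('i *: z); rewrite fZ innerZl; have := key z.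
by case: (f z) (inner z l) => a b [p q] /= ->; rewrite !mul0r !mul1r !sub0r => /oppr_inj ->.
Qed.

Lemma adjoint_ex (T : 'B(H)) : exists S, is_adjoint T S.
Proof.
have [M M0 TM] := bop_bounded T.
have rep y : exists z, forall x, inner (T x) y = inner x z.
  apply: (@riesz _ (M * rnorm y)) => [a x1 x2|x]; first by rewrite linearP inner_linearl.
  rewrite (le_trans (Re_inner_CS _ _))//.
  by rewrite [leRHS]mulrAC ler_wpM2r ?rnorm_ge0.
have [S SP] := choice rep.
have Sbd : S \in @bounded_pred R H H.
  apply/asboolP; split.
    move=> a x y; apply/esym/inner_inj => z.
    apply: (can_inj (@conjcK R)); rewrite -!inner_conj.
    by rewrite -SP !innerDr !innerZr -!SP.
  exists M => y; have [->|Sy0] := eqVneq (rnorm (S y)) 0.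
    by rewrite mulr_ge0 ?rnorm_ge0.
  have Sy : 0 < rnorm (S y) by rewrite lt_neqAle eq_sym Sy0 rnorm_ge0.
  rewrite -(ler_pM2l Sy) -expr2 rnorm_sqr_inner -SP.
  rewrite (le_trans (Re_inner_CS _ _))// mulrA ler_wpM2r ?rnorm_ge0//.
  by rewrite [leRHS]mulrC TM.
by exists (Bop Sbd) => x y /=.
Qed.

End Riesz.

(** * Norm convergence of operators *)

Section OperatorNorm.
Context {R : realType} {H K : hilbertType R}.
Implicit Types T : bop H K.

Lemma rnorm_opnorm T x : rnorm (T x) <= opnorm T * rnorm x.
Proof.
have [M M0 TM] := bop_bounded T.
pose B := [set rnorm (T x) | x in [set x | rnorm x <= 1]].
have supB y : rnorm y <= 1 -> rnorm (T y) <= opnorm T.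
  move=> y1; apply: (@sup_ubound _ B); last by exists y.
  exists M => _ [z /= z1 <-]; rewrite (le_trans (TM z))//.
  by rewrite -[leRHS]mulr1 ler_wpM2l.
have [x0|x0] := eqVneq (rnorm x) 0.
  by rewrite (rnorm_eq0 x0) linear0 !rnorm0 mulr0.
have xp : 0 < rnorm x by rewrite lt_neqAle eq_sym x0 rnorm_ge0.
have := supB ((rnorm x)^-1%:C *: x); rewrite linearZ/= !rnormZr ger0_norm ?invr_ge0 ?(ltW xp)//.
by rewrite mulVf// lexx => /(_ isT); rewrite ler_pdivrMl// mulrC.
Qed.

Lemma opnorm_ge0 T : 0 <= opnorm T.
Proof.
rewrite /opnorm; have [M M0 TM] := bop_bounded T.
apply: le_trans (rnorm_ge0 (T 0)) _; apply: sup_ubound.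
  exists M => _ [z /= z1 <-]; rewrite (le_trans (TM z))//.
  by rewrite -[leRHS]mulr1 ler_wpM2l.
by exists 0 => //=; rewrite rnorm0.
Qed.

Lemma opnorm_le T (M : R) : 0 <= M -> (forall x, rnorm (T x) <= M * rnorm x) ->
  opnorm T <= M.
Proof.
move=> M0 TM; apply: ge_sup; first by exists (rnorm (T 0)), 0 => //=; rewrite rnorm0.
by move=> _ [x /= x1 <-]; rewrite (le_trans (TM x))// -[leRHS]mulr1 ler_wpM2l.
Qed.

Lemma bop_sumE (I : Type) (r : seq I) (P : pred I) (F : I -> bop H K) x :
  (\sum_(i <- r | P i) F i) x = \sum_(i <- r | P i) F i x.
Proof. exact: (big_morph (fun T : bop H K => T x)). Qed.

End OperatorNorm.

Section OperatorConvergence.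
Context {R : realType}.
Implicit Types H K L : hilbertType R.

(** Convergence in operator norm, through a real rate: the operators form a
    plain module here, without a topology of their own. *)
Definition op_cvg H K (u : nat -> bop H K) (T : bop H K) : Prop :=
  exists2 r : nat -> R, r @ \oo --> 0 &
    forall N x, rnorm (T x - u N x) <= r N * rnorm x.

Lemma op_cvg_cst H K (T : bop H K) : op_cvg (fun=> T) T.
Proof.
exists (fun=> 0); first exact: cvg_cst.
by move=> _ x; rewrite subrr rnorm0 mul0r.
Qed.

Lemma op_cvgD H K (u v : nat -> bop H K) S T :
  op_cvg u S -> op_cvg v T -> op_cvg (fun N => u N + v N) (S + T).
Proof.
move=> [r r0 ur] [s s0 vs]; exists (r \+ s); first by rewrite -(addr0 0); exact: cvgD.
move=> N x; rewrite !bopDE opprD addrACA mulrDl.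
by rewrite (le_trans (rnormD _ _))// lerD.
Qed.

Lemma op_cvg_sum H K (I : finType) (u : I -> nat -> bop H K) (T : I -> bop H K) :
  (forall i, op_cvg (u i) (T i)) ->
  op_cvg (fun N => \sum_i u i N) (\sum_i T i).
Proof.
move=> uT; elim: (index_enum I) => [|i s IH].
  rewrite big_nil (_ : (fun N => _) = fun=> 0); first exact: op_cvg_cst.
  by apply/funext => N; rewrite big_nil.
rewrite big_cons (_ : (fun N => _) = fun N => u i N + \sum_(j <- s) u j N).
  exact: op_cvgD.
by apply/funext => N; rewrite big_cons.
Qed.

Lemma op_cvg_comp H K L L' (S : bop K L) (u : nat -> bop H K) T (S' : bop L' H) :
  op_cvg u T ->
  op_cvg (fun N => bop_comp S (bop_comp (u N) S')) (bop_comp S (bop_comp T S')).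
Proof.
move=> [r r0 ur]; exists (fun N => opnorm S * opnorm S' * `|r N|).
  rewrite -(mulr0 (opnorm S * opnorm S')); apply: cvgM; first exact: cvg_cst.
  by rewrite -(normr0 R); exact: cvg_norm.
move=> N x /=; rewrite -linearB/= (le_trans (rnorm_opnorm _ _))// -!mulrA.
rewrite ler_wpM2l ?opnorm_ge0// mulrCA (le_trans (ur _ _))//.
rewrite (@le_trans _ _ (`|r N| * rnorm (S' x)))//.
  by rewrite ler_wpM2r ?rnorm_ge0// ler_norm.
by rewrite ler_wpM2l// rnorm_opnorm.
Qed.

Lemma op_cvgMl H (S : 'B(H)) u T : op_cvg u T -> op_cvg (fun N => S * u N) (S * T).
Proof.
move=> /(op_cvg_comp S (bop_id H)); rewrite (_ : bop_comp _ _ = S * T).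
  by congr op_cvg; apply/funext => N; exact: bop_eqP.
exact: bop_eqP.
Qed.

Lemma op_cvgMr H (S : 'B(H)) u T : op_cvg u T -> op_cvg (fun N => u N * S) (T * S).
Proof.
move=> /(op_cvg_comp (bop_id H) S); rewrite (_ : bop_comp _ _ = T * S).
  by congr op_cvg; apply/funext => N; exact: bop_eqP.
exact: bop_eqP.
Qed.

Lemma op_cvgZ H K (a : R[i]) (u : nat -> bop H K) T :
  op_cvg u T -> op_cvg (fun N => a *: u N) (a *: T).
Proof.
move=> [r r0 ur]; exists (fun N => complex.Re `|a| * r N).
  by rewrite -(mulr0 (complex.Re `|a|)); apply: cvgM => //; exact: cvg_cst.
move=> N x; rewrite !bopZE -scalerBr rnormZ -mulrA ler_wpM2l//.
exact: (rnorm_ge0 (a : R[i]^o)).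
Qed.

Lemma op_cvg_unique H K (u : nat -> bop H K) S T :
  op_cvg u S -> op_cvg u T -> S = T.
Proof.
move=> [r r0 ur] [s s0 us]; apply: bop_eqP => x; apply/eqP; rewrite -subr_eq0.
apply/eqP/rnorm_eq0/eqP; rewrite eq_le rnorm_ge0 andbT.
apply: (@le_cvg0 _ _ (fun N => (r N + s N) * rnorm x)).
  move=> N; have -> : S x - T x = (S x - u N x) - (T x - u N x).
    by rewrite opprB addrA subrK.
  by rewrite (le_trans (rnormD _ _))// rnormN mulrDl lerD.
rewrite -[X in _ --> X](mul0r (rnorm x)) -(addr0 0).
by apply: cvgM; [exact: cvgD|exact: cvg_cst].
Qed.

Lemma complex_ge0_lim (z : nat -> R[i]) (l : R[i]) (r : nat -> R) :
  (forall N, 0 <= z N) -> (forall N, `|l - z N| <= (r N)%:C) -> r @ \oo --> 0 -> 0 <= l.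
Proof.
move=> z0 zr r0; rewrite lecE /=.
have zE N : 0 <= complex.Re (z N) /\ complex.Im (z N) = 0.
  by have := z0 N; case: (z N) => a b; rewrite lecE /= => /andP[/eqP -> ->].
have ReIm N : `|complex.Re (l - z N)| <= r N /\ `|complex.Im (l - z N)| <= r N.
  have := zr N; case: (l - z N) => a b; rewrite normc_def lecR /= => h.
  by split; apply: le_trans h; rewrite -sqrtr_sqr ler_wsqrtr// ?lerDl ?lerDr sqr_ge0.
apply/andP; split.
  rewrite -normr_le0; apply: (le_cvg0 _ r0) => N.
  by have := (ReIm N).2; rewrite raddfB/= (zE N).2 subr0.
rewrite -oppr_le0; apply: (le_cvg0 _ r0) => N.
have [z1 _] := zE N; have [+ _] := ReIm N.
by rewrite raddfB/= ler_norml => /andP[? _]; lra.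
Qed.

Lemma op_cvg_ge0 H (u : nat -> 'B(H)) T x : op_cvg u T ->
  (forall N, 0 <= inner (u N x) x) -> 0 <= inner (T x) x.
Proof.
move=> [r r0 uT] u0.
apply: (@complex_ge0_lim _ _ (fun N => r N * (rnorm x * rnorm x)) u0).
  move=> N; rewrite -innerBl (le_trans (inner_CS _ _))// lecR mulrA.
  by rewrite ler_wpM2r ?rnorm_ge0.
by rewrite -[X in _ --> X](mul0r (rnorm x * rnorm x)); apply: cvgM => //; exact: cvg_cst.
Qed.

Lemma op_cvg_le H K (u : nat -> bop H K) T (M : R) x : op_cvg u T ->
  (forall N, rnorm (u N x) <= M) -> rnorm (T x) <= M.
Proof.
move=> [r r0 uT] uM; rewrite -subr_le0.
apply: (@le_cvg0 _ _ (fun N => r N * rnorm x)) => [N|].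
  rewrite -(subrK (u N x) (T x)) lerBlDr (le_trans (rnormD _ _))//.
  by rewrite lerD.
by rewrite -[X in _ --> X](mul0r (rnorm x)); apply: cvgM => //; exact: cvg_cst.
Qed.

(** The increments of a play the role of the norms of the terms of a series;
    its convergence gives the absolute convergence of the operator series. *)
Lemma op_cvg_ex H K (u : nat -> bop H K) (a : nat -> R) (l : R) :
  (forall N, a N <= a N.+1) -> a @ \oo --> l ->
  (forall N x, rnorm (u N.+1 x - u N x) <= (a N.+1 - a N) * rnorm x) ->
  exists T, op_cvg u T.
Proof.
move=> aS al uS.
have and : nondecreasing_seq a by exact/nondecreasing_seqP.
have la N : a N <= l.
  rewrite -(cvg_lim (@Rhausdorff R) al); apply: nondecreasing_cvgn_le => //.
  by apply/cvg_ex; exists l.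
have uMN M N x : (M <= N)%N -> rnorm (u N x - u M x) <= (l - a M) * rnorm x.
  move=> MN; apply: (@le_trans _ _ ((a N - a M) * rnorm x)); last first.
    by rewrite ler_wpM2r ?rnorm_ge0// lerD2r.
  elim: N MN => [|N IH]; first by rewrite leqn0 => /eqP ->; rewrite !subrr rnorm0 mul0r.
  rewrite leq_eqVlt => /orP[/eqP ->|]; first by rewrite !subrr rnorm0 mul0r.
  rewrite ltnS => /IH h.
  have -> : u N.+1 x - u M x = (u N.+1 x - u N x) + (u N x - u M x) by rewrite addrA subrK.
  rewrite (le_trans (rnormD _ _))// (le_trans (lerD (uS _ _) h))//.
  by rewrite -mulrDl addrA subrK.
have r0 : (fun N => l - a N) @ \oo --> 0.
  by rewrite -(subrr l); apply: cvgB => //; exact: cvg_cst.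
have rx0 (c : R) : (fun N => (l - a N) * c) @ \oo --> 0.
  by rewrite -(mul0r c); apply: cvgM => //; exact: cvg_cst.
have /choice[T TP] x : exists y, forall N, rnorm (y - u N x) <= (l - a N) * rnorm x.
  by apply: rnorm_cvg_ex => // M N MN; exact: uMN.
have Tbd : T \in @bounded_pred R H K.
  apply/asboolP; split.
    move=> c x y; apply/eqP; rewrite -subr_eq0; apply/eqP/rnorm_eq0/eqP.
    rewrite eq_le rnorm_ge0 andbT.
    pose k := rnorm (c *: x + y) + complex.Re `|c| * rnorm x + rnorm y.
    apply: (@le_cvg0 _ _ (fun N => (l - a N) * k)) => // N.
    have -> : T (c *: x + y) - (c *: T x + T y) =
        (T (c *: x + y) - u N (c *: x + y)) - (c *: (T x - u N x) + (T y - u N y)).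
      have aux (A B C : K) : A - B = (A - C) - (B - C) by rewrite opprB addrA subrK.
      by rewrite (aux _ _ (u N (c *: x + y))) linearP scalerBr opprD addrACA.
    rewrite (le_trans (rnormD _ _))// rnormN /k -addrA mulrDr lerD//.
    rewrite (le_trans (rnormD _ _))// rnormZ mulrDr lerD// mulrCA ler_wpM2l//.
    exact: (rnorm_ge0 (c : R[i]^o)).
  exists (opnorm (u 0%N) + (l - a 0%N)) => x.
  rewrite -(subrK (u 0%N x) (T x)) (le_trans (rnormD _ _))// mulrDl addrC.
  by rewrite lerD// rnorm_opnorm.
by exists (Bop Tbd), (fun N => l - a N).
Qed.

End OperatorConvergence.

(** * Positive operators and *-homomorphisms *)

Section PositiveOperators.
Context {R : realType}.
Implicit Types H K L : hilbertType R.

Definition op_ge0 H (T : 'B(H)) : Prop := forall v, 0 <= inner (T v) v.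

Lemma is_adjoint_sym H (S T : 'B(H)) : is_adjoint S T -> is_adjoint T S.
Proof. by move=> ST x y; rewrite inner_conj -ST -inner_conj. Qed.

Lemma is_adjoint_unique H (S T T' : 'B(H)) :
  is_adjoint S T -> is_adjoint S T' -> T = T'.
Proof.
move=> ST ST'; apply: bop_eqP => x; apply: inner_inj => y.
by apply: (can_inj (@conjcK R)); rewrite -!inner_conj -ST ST'.
Qed.

(** Polarization: a form that is real on the diagonal is hermitian. *)
Lemma op_ge0_adjoint H (T : 'B(H)) : op_ge0 T -> is_adjoint T T.
Proof.
move=> T0.
have imT v w : complex.Im (inner (T v) w) + complex.Im (inner (T w) v) = 0.
  have im0 x : complex.Im (inner (T x) x) = 0.
    by have := T0 x; case: (inner _ _) => a b; rewrite lecE /= => /andP[/eqP].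
  have := im0 (v + w); rewrite linearD !innerDl !innerDr !raddfD /= !im0.
  by rewrite add0r addr0.
move=> w v; rewrite [RHS]inner_conj.
have := imT v w; have := imT v ('i *: w).
rewrite linearZ/= innerZl innerZr.
case: (inner (T w) v) (inner (T v) w) => a b [p q] /= h1 h2.
by congr Complex; lra.
Qed.

Lemma adjoint_op_ge0 H (T : 'B(H)) : is_adjoint T T ->
  (forall v, 0 <= complex.Re (inner (T v) v)) -> op_ge0 T.
Proof.
move=> Tsa T0 v; have := T0 v; have := Tsa v v; rewrite [in RHS]inner_conj.
case: (inner (T v) v) => a b /= [] h a0; rewrite lecE /= a0 andbT; apply/eqP; lra.
Qed.

(** The inequality T^2 <= k T for 0 <= T <= k, without square roots: it is the
    discriminant condition for s |-> <T w, w> at w = v - s *: T v, a quadratic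
    polynomial whose leading coefficient is at most k |T v|^2. *)
Lemma op_ge0_rnorm_sqr H (T : 'B(H)) (k : R) v : op_ge0 T ->
  (forall w, complex.Re (inner (T w) w) <= k * rnorm w ^+ 2) ->
  rnorm (T v) ^+ 2 <= k * complex.Re (inner (T v) v).
Proof.
move=> T0 Tk; have Tsa := op_ge0_adjoint T0.
have re0 w : 0 <= complex.Re (inner (T w) w) by have := T0 w; rewrite lecE => /andP[].
have h : (- rnorm (T v) ^+ 2) ^+ 2 <=
    complex.Re (inner (T v) v) * (k * rnorm (T v) ^+ 2).
  apply: quadratic_ge0; first exact: le_trans (Tk _).
  move=> s; have := re0 (v - s%:C *: T v).
  rewrite linearB linearZ/= innerBl !innerBr !raddfB/= !(Re_innerZr, Re_innerZl).
  rewrite (Tsa (T v) v) -rnorm_sqr_inner => h.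
  have : s ^+ 2 * complex.Re (inner (T (T v)) (T v)) <= s ^+ 2 * (k * rnorm (T v) ^+ 2).
    by rewrite ler_wpM2l ?sqr_ge0.
  by move=> ?; lra.
have [z|nz] := eqVneq (rnorm (T v) ^+ 2) 0.
  have -> : inner (T v) v = 0.
    by move/eqP: z; rewrite sqrf_eq0 => /eqP/rnorm_eq0 ->; rewrite inner0l.
  by rewrite z mulr0.
have p : 0 < rnorm (T v) ^+ 2 by rewrite lt_neqAle eq_sym nz sqr_ge0.
rewrite -(ler_pM2l p); move: h; rewrite sqrrN; lra.
Qed.

Record norm_closed_algebra H (A : set 'B(H)) : Prop := {
  nca_one : A 1 ;
  nca_subspace : Defs.subspace A ;
  nca_mul : forall S T, A S -> A T -> A (S * T) ;
  nca_closed : forall u T, (forall N, A (u N)) -> op_cvg u T -> A T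
}.

Lemma subspaceZ H K (A : set (bop H K)) (a : R[i]) T : Defs.subspace A -> A T -> A (a *: T).
Proof. by move=> [A0 AL] AT; rewrite -[_ *: _]addr0; exact: AL. Qed.

Lemma subspaceD H K (A : set (bop H K)) S T : Defs.subspace A -> A S -> A T -> A (S + T).
Proof. by move=> [A0 AL] AS AT; rewrite -[S]scale1r; exact: AL. Qed.

Lemma subspaceB H K (A : set (bop H K)) S T : Defs.subspace A -> A S -> A T -> A (S - T).
Proof. by move=> sA AS AT; rewrite -scaleN1r; apply: subspaceD => //; exact: subspaceZ. Qed.

Lemma subspace_sum H K (A : set (bop H K)) (I : finType) (F : I -> bop H K) :
  Defs.subspace A -> (forall i, A (F i)) -> A (\sum_i F i).
Proof.
by move=> sA AF; apply: big_ind => // [|S T AS AT]; [case: sA|exact: subspaceD].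
Qed.

(** The Neumann series. *)
Lemma neumann H (A : set 'B(H)) (Z : 'B(H)) (q : R) :
  norm_closed_algebra A -> A Z -> 0 <= q < 1 ->
  (forall v, rnorm (Z v) <= q * rnorm v) ->
  exists2 Y, A Y & Y * (1 - Z) = 1.
Proof.
move=> nA AZ /andP[q0 q1] Zq.
have q10 : 0 < 1 - q by rewrite subr_gt0.
have q1a : `|q| < 1 by rewrite ger0_norm.
have Zn n v : rnorm ((Z ^+ n) v) <= q ^+ n * rnorm v.
  elim: n v => [|n IH] v; first by rewrite !expr0 mul1r.
  rewrite exprSr bopME (le_trans (IH _))// exprSr -mulrA ler_wpM2l//.
  by rewrite exprn_ge0.
pose u N : 'B(H) := \sum_(i < N) Z ^+ i.
have AZn n : A (Z ^+ n).
  elim: n => [|n IH]; first by rewrite expr0; exact: nca_one.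
  by rewrite exprS; exact: nca_mul.
have Au N : A (u N) by apply: subspace_sum => //; exact: nca_subspace.
have uS N v : u N.+1 v - u N v = (Z ^+ N) v.
  have -> : u N.+1 = u N + Z ^+ N by rewrite /u big_ord_recr.
  by rewrite bopDE addrAC subrr add0r.
pose a N := - (1 - q)^-1 * q ^+ N.
have aS N : a N.+1 - a N = q ^+ N.
  by rewrite /a exprSr; field; rewrite gt_eqF.
have [|||Y uY] := @op_cvg_ex R H H u a 0.
- by move=> N; rewrite -subr_ge0 aS exprn_ge0.
- exact: geometric_cvg0.
- by move=> N v; rewrite uS aS.
exists Y; first exact: (nca_closed nA Au).
apply: (op_cvg_unique (op_cvgMr (1 - Z) uY)).
have uZ N : u N * (1 - Z) = 1 - Z ^+ N.
  rewrite /u; elim: N => [|N IH]; first by rewrite big_ord0 mul0r expr0 subrr.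
  by rewrite big_ord_recr/= mulrDl IH mulrBr mulr1 -exprSr addrA subrK.
exists (fun N => 1 * q ^+ N); first exact: geometric_cvg0.
by move=> N x; rewrite uZ mul1r bopDE bopNE opprD opprK addrA subrr add0r.
Qed.

(** With k = |X|, the operator X + t equals (k + t) (1 - Z) for
    Z = (k - X) / (k + t), whose norm is at most k / (k + t) < 1. *)
Lemma op_ge0_inverse H (A : set 'B(H)) (X : 'B(H)) (t : R) :
  norm_closed_algebra A -> A X -> op_ge0 X -> 0 < t ->
  exists2 Y, A Y & Y * (X + t%:C *: (1 : 'B(H))) = 1.
Proof.
move=> nA AX X0 t0; pose k := opnorm X.
have k0 : 0 <= k := opnorm_ge0 X.
have kt : 0 < k + t by rewrite ltr_wpDl.
pose W : 'B(H) := k%:C *: (1 : 'B(H)) - X.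
have WE w : inner (W w) w = (k * rnorm w ^+ 2)%:C - inner (X w) w.
  by rewrite /W bopDE bopNE bopZE bop1E innerBl innerZl inner_rnormE -rmorphM.
have X1 w : complex.Re (inner (X w) w) <= k * rnorm w ^+ 2.
  rewrite (le_trans (Re_inner_CS _ _))// expr2 mulrA ler_wpM2r ?rnorm_ge0//.
  exact: rnorm_opnorm.
have W0 : op_ge0 W.
  move=> w; rewrite WE; have := X0 w; have := X1 w.
  case: (inner _ _) => p r; rewrite !lecE /= => h /andP[/eqP -> _].
  by rewrite subrr eqxx subr_ge0 h.
have W1 w : complex.Re (inner (W w) w) <= k * rnorm w ^+ 2.
  rewrite WE; have := X0 w; case: (inner _ _) => p r; rewrite !lecE /= => /andP[_ p0].
  by rewrite lerBlDr lerDl.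
have Wk w : rnorm (W w) <= k * rnorm w.
  rewrite -(ler_pXn2r (n := 2))// ?nnegrE ?mulr_ge0 ?rnorm_ge0//.
  rewrite (le_trans (op_ge0_rnorm_sqr w W0 W1))// exprMn expr2 -mulrA.
  by rewrite ler_wpM2l.
pose Z := (k + t)^-1%:C *: W.
have AZ : A Z.
  have sA := nca_subspace nA; apply: subspaceZ => //; apply: subspaceB => //.
  by apply: subspaceZ => //; exact: nca_one.
have [||Y AY YZ] := @neumann H A Z (k / (k + t)) nA AZ.
- by rewrite divr_ge0 ?(ltW kt)//= ltr_pdivrMr// mul1r ltrDl.
- move=> v; rewrite bopZE rnormZr ger0_norm ?invr_ge0 ?(ltW kt)//.
  by rewrite [k / _]mulrC -mulrA ler_wpM2l// invr_ge0 ltW.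
exists ((k + t)^-1%:C *: Y); first exact: subspaceZ (nca_subspace nA) AY.
have ZE : 1 - Z = (k + t)^-1%:C *: (X + t%:C *: (1 : 'B(H))).
  apply: bop_eqP => x; rewrite /Z /W.
  rewrite !(bopDE, bopNE, bopZE, bop1E) !(scalerDr, scalerN) opprD opprK !scalerA.
  rewrite addrA addrC; congr (_ + _).
  rewrite -[X in X - _]scale1r -scalerBl; congr (_ *: _).
  rewrite -!rmorphM -(rmorph1 (real_complex R)) -rmorphB/=; congr (_%:C).
  by field; rewrite gt_eqF.
rewrite -[RHS]YZ ZE; apply: bop_eqP => x.
by rewrite bopME bopZE bopME bopZE linearZ.
Qed.

Record star_hom H K (A : set 'B(H)) (pi : 'B(H) -> 'B(K)) : Prop := {
  sh_linear : linear_on A pi ;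
  sh_one : pi 1 = 1 ;
  sh_mul : forall S T, A S -> A T -> pi (S * T) = pi S * pi T ;
  sh_adjoint : forall S T, A S -> A T -> is_adjoint S T -> is_adjoint (pi S) (pi T)
}.

(** Suppose that the lower bound m of b = pi X were negative. A left
    inverse Y of X - m lies in A, so c = b - m has a bounded left inverse pi Y. As c >= 0,
    op_ge0_rnorm_sqr gives |v|^2 <= |pi Y|^2 |c v|^2 <= |pi Y|^2 |c| <c v, v>,
    so c is bounded below by a positive constant, which contradicts the choice
    of m. Boundedness of pi is not presupposed. *)
Lemma star_hom_ge0 H K (A : set 'B(H)) (pi : 'B(H) -> 'B(K)) X :
  norm_closed_algebra A -> star_hom A pi -> A X -> op_ge0 X -> op_ge0 (pi X).
Proof.
move=> nA pA AX X0; have bsa := sh_adjoint pA AX AX (op_ge0_adjoint X0).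
apply: adjoint_op_ge0 => //.
set b := pi X in bsa *.
pose f v := complex.Re (inner (b v) v).
pose B := [set f v | v in [set v | rnorm v <= 1]].
have fZ (s : R) v : f (s%:C *: v) = s ^+ 2 * f v.
  by rewrite /f linearZ/= Re_innerZl Re_innerZr mulrA.
have f0 : f 0 = 0 by rewrite /f inner0r.
have Binf : has_inf B.
  split; first by exists 0, 0 => //=; rewrite rnorm0.
  exists (- opnorm b) => _ [v /= v1 <-]; rewrite lerNl.
  have := Re_inner_CS (b v) (- v); rewrite innerNr raddfN rnormN/= => /le_trans; apply.
  rewrite -[leRHS]mulr1 (@le_trans _ _ (opnorm b * rnorm v * rnorm v))//.
    by rewrite ler_wpM2r ?rnorm_ge0// rnorm_opnorm.
  by rewrite -mulrA ler_wpM2l ?opnorm_ge0// -expr2 exprn_ile1 ?rnorm_ge0.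
pose m := inf B.
have mf v : m * rnorm v ^+ 2 <= f v.
  have [z|nz] := eqVneq (rnorm v) 0.
    by rewrite (rnorm_eq0 z) rnorm0 f0 expr0n mulr0.
  have vp : 0 < rnorm v by rewrite lt_neqAle eq_sym nz rnorm_ge0.
  have : m <= f ((rnorm v)^-1%:C *: v).
    apply: ge_inf; first by case: Binf.
    by exists ((rnorm v)^-1%:C *: v) => //=; rewrite rnormZr ger0_norm ?invr_ge0 ?(ltW vp)// mulVf.
  by rewrite fZ exprVn ler_pdivlMl ?exprn_gt0// mulrC.
have [m0|m0] := leP 0 m.
  by move=> v; apply: le_trans (mf v); rewrite mulr_ge0 ?sqr_ge0.
have t0 : 0 < - m by rewrite oppr_gt0.
have [Y AY YX] := op_ge0_inverse nA AX X0 t0.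
pose c : 'B(K) := b + (- m)%:C *: (1 : 'B(K)).
have cE v : inner (c v) v = inner (b v) v + (- m * rnorm v ^+ 2)%:C.
  by rewrite /c bopDE bopZE bop1E innerDl innerZl inner_rnormE -rmorphM.
have cf v : complex.Re (inner (c v) v) = f v - m * rnorm v ^+ 2.
  by rewrite cE raddfD/= mulNr.
have Yc v : pi Y (c v) = v.
  have -> : c = pi (X + (- m)%:C *: (1 : 'B(H))).
    rewrite addrC (sh_linear pA)//; last exact: nca_one.
    by rewrite (sh_one pA) addrC.
  rewrite -bopME -(sh_mul pA)// ?YX ?(sh_one pA)//.
  have sA := nca_subspace nA; apply: subspaceD => //; apply: subspaceZ => //.
  exact: nca_one.
have c0 : op_ge0 c.
  apply: adjoint_op_ge0.
    move=> v w; rewrite /c !bopDE !bopZE !bop1E innerDl innerDr bsa innerZl innerZr.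
    by congr (_ + _ * _); apply/eqP; rewrite eq_complex/= oppr0 !eqxx.
  by move=> v; rewrite cf subr_ge0.
pose k := opnorm c; pose M := opnorm (pi Y).
have ck w : complex.Re (inner (c w) w) <= k * rnorm w ^+ 2.
  rewrite (le_trans (Re_inner_CS _ _))// expr2 mulrA ler_wpM2r ?rnorm_ge0//.
  exact: rnorm_opnorm.
have d0 : 0 < M ^+ 2 * k + 1 by rewrite ltr_wpDl// mulr_ge0 ?sqr_ge0// opnorm_ge0.
pose eps := (M ^+ 2 * k + 1)^-1.
have eps0 : 0 < eps by rewrite invr_gt0.
have feps v : (m + eps) * rnorm v ^+ 2 <= f v.
  have h1 : rnorm v ^+ 2 <= M ^+ 2 * rnorm (c v) ^+ 2.
    rewrite -{1}(Yc v) -exprMn ler_pXn2r// ?nnegrE ?mulr_ge0 ?rnorm_ge0 ?opnorm_ge0//.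
    exact: rnorm_opnorm.
  have h2 := op_ge0_rnorm_sqr v c0 ck.
  have h3 : 0 <= complex.Re (inner (c v) v) by rewrite cf subr_ge0.
  have h4 : rnorm v ^+ 2 <= (M ^+ 2 * k + 1) * complex.Re (inner (c v) v).
    rewrite (le_trans h1)// mulrDl mul1r -mulrA ler_wpDr// ler_wpM2l// sqr_ge0.
    by [].
  rewrite mulrDl -lerBrDl -cf /eps ler_pdivrMl//.
have : Num.min 0 (m + eps) <= m.
  apply: lb_le_inf; first by case: Binf.
  move=> _ [v /= v1 <-]; apply: le_trans (feps v).
  have v2 : rnorm v ^+ 2 <= 1 by rewrite exprn_ile1 ?rnorm_ge0.
  have v0 := sqr_ge0 (rnorm v).
  by case: (leP 0 (m + eps)) => h; [rewrite mulr_ge0|nra].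
by rewrite ge_min => /orP[|]; lra.
Qed.

End PositiveOperators.

(** * Matrices of operators *)

Section OperatorMatrices.
Context {R : realType}.
Implicit Types H K L : hilbertType R.

Lemma inner_tens_delta (I : choiceType) H (i : I) (x : H) (y : ell2 I H) :
  inner (tens_delta i x) y = inner x (y i).
Proof.
pose z k := inner (tens_delta i x k) (y k).
have zE k : z k = if k \in [set i]%classic then inner x (y i) else 0.
  rewrite /z tens_deltaE; case: (eqVneq k i) => [->|ki]; first by rewrite mem_set.
  by rewrite inner0l memNset//= => /eqP; rewrite (negbTE ki).
have s1 (f : I -> R) (a : R) :
    (forall k, f k = if k \in [set i]%classic then a else 0) -> rsum f = a.
  move=> fE; rewrite /rsum.
  have -> : ((EFin \o f)^\+)%E = fun k =>
      if k \in [set i]%classic then (Num.max a 0)%:E else 0%E.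
    by apply/funext => k; rewrite funeposE/= fE; case: ifP => _; rewrite ?EFin_max ?maxxx.
  have -> : ((EFin \o f)^\-)%E = fun k =>
      if k \in [set i]%classic then (Num.max (- a) 0)%:E else 0%E.
    apply/funext => k; rewrite funenegE/= fE; case: ifP => _; first by rewrite EFin_max.
    by rewrite oppr0 maxxx.
  rewrite -!esum_mkcond !esum_set1 ?lee_fin ?le_max ?lexx ?orbT//=.
  case: (leP a 0) => h.
    by rewrite max_l ?oppr_ge0// sub0r opprK.
  by rewrite max_r ?subr0// oppr_le0 ltW.
apply/eqP; rewrite eq_complex; apply/andP; split; apply/eqP.
  by apply: s1 => k; rewrite -/(z k) zE; case: ifP.
by apply: s1 => k; rewrite -/(z k) zE; case: ifP.
Qed.

Lemma inner_tens_deltar (I : choiceType) H (i : I) (x : H) (y : ell2 I H) :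
  inner y (tens_delta i x) = inner (y i) x.
Proof. by rewrite [LHS]inner_conj inner_tens_delta -inner_conj. Qed.

Lemma ell2_sumE (I : choiceType) H (J : Type) (r : seq J) (P : pred J)
    (F : J -> ell2 I H) i :
  (\sum_(j <- r | P j) F j) i = \sum_(j <- r | P j) F j i.
Proof. exact: (big_morph (fun f : ell2 I H => f i)). Qed.

(** A finite matrix of operators on H, seen as one operator on ell2 I H; its
    positivity is that of the matrix, which makes the results on single
    operators available for matrices. *)
Section Mx.
Context {I : finType} {H : hilbertType R}.
Implicit Types (M N : I -> I -> 'B(H)) (v : ell2 I H).

Definition fin_vec (v : I -> H) : ell2 I H := \sum_i tens_delta i (v i).

Lemma fin_vecE (v : I -> H) i : fin_vec v i = v i.
Proof.
rewrite /fin_vec ell2_sumE (bigD1 i)//= big1 ?addr0 ?eqxx//.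
by move=> j ji; rewrite eq_sym (negbTE ji).
Qed.

Lemma fin_vec_id v : fin_vec v = v.
Proof. by apply: ell2_eqP => i; exact: fin_vecE. Qed.

Definition mxop M : 'B(ell2 I H) :=
  \sum_i \sum_j bop_comp (tens_delta i) (bop_comp (M i j) (Defs.coord j)).

Lemma mxopE M v i : mxop M v i = \sum_j M i j (v j).
Proof.
rewrite -[RHS](fin_vecE (fun i => \sum_j M i j (v j))); congr (ell2_fun _ i).
rewrite /mxop bop_sumE; apply: eq_bigr => k _; rewrite bop_sumE linear_sum.
by apply: eq_bigr => j _.
Qed.

Lemma block_mxop M i j : block (mxop M) i j = M i j.
Proof.
apply: bop_eqP => x; rewrite blockE mxopE (bigD1 j)// tens_deltaE eqxx.
rewrite big1 => [|k /andP[_ kj]]; first exact: addr0.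
by rewrite tens_deltaE (negbTE kj) linear0.
Qed.

Lemma mxop_block (T : 'B(ell2 I H)) : mxop (block T) = T.
Proof.
apply: bop_eqP => v; apply: ell2_eqP => i; rewrite mxopE.
by rewrite -[in RHS](fin_vec_id v) /fin_vec linear_sum ell2_sumE.
Qed.

Lemma inner_mxop M v w :
  inner (mxop M v) w = \sum_i \sum_j inner (M i j (v j)) (w i).
Proof.
rewrite /mxop bop_sumE inner_suml; apply: eq_bigr => i _.
rewrite bop_sumE inner_suml; apply: eq_bigr => j _.
by rewrite [LHS]inner_tens_delta.
Qed.

Lemma mxop_ge0P M : op_ge0 (mxop M) <->
  forall v : I -> H, 0 <= \sum_i \sum_j inner (M i j (v j)) (v i).
Proof.
split=> [h v|h v]; last by rewrite inner_mxop.
have := h (fin_vec v); rewrite inner_mxop; congr (0 <= _).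
by apply: eq_bigr => i _; apply: eq_bigr => j _; rewrite !fin_vecE.
Qed.

Lemma op_cvg_mxop (u : I -> I -> nat -> 'B(H)) (T : I -> I -> 'B(H)) :
  (forall i j, op_cvg (u i j) (T i j)) ->
  op_cvg (fun k => mxop (fun i j => u i j k)) (mxop T).
Proof. by move=> uT; do 2!apply: op_cvg_sum => ?; exact: op_cvg_comp. Qed.

Lemma block_mul (S T : 'B(ell2 I H)) i j :
  block (S * T) i j = \sum_k block S i k * block T k j.
Proof.
apply: bop_eqP => x; rewrite blockE bop_sumE bopME -{1}(mxop_block S) mxopE.
by apply: eq_bigr => k _.
Qed.

Lemma block1 i j : block (1 : 'B(ell2 I H)) i j = if i == j then 1 else 0.
Proof. by apply: bop_eqP => x; rewrite blockE; case: ifP => h /=; rewrite h. Qed.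

End Mx.
End OperatorMatrices.

(** * Completely positive maps *)

Section CompletelyPositive.
Context {R : realType}.
Implicit Types H K L : hilbertType R.

Lemma linear_on0 H K (A : set 'B(H)) (pi : 'B(H) -> 'B(K)) :
  Defs.subspace A -> linear_on A pi -> pi 0 = 0.
Proof.
move=> [A0 _] pl; have := pl 1 0 0 A0 A0; rewrite !scale1r addr0 => h.
by apply: (addrI (pi 0)); rewrite -h addr0.
Qed.

Lemma linear_onZ H K (A : set 'B(H)) (pi : 'B(H) -> 'B(K)) a T :
  Defs.subspace A -> linear_on A pi -> A T -> pi (a *: T) = a *: pi T.
Proof.
move=> sA pl AT; rewrite -[_ *: T]addr0 pl//; last by case: sA.
by rewrite (linear_on0 sA pl) addr0.
Qed.

Lemma linear_onD H K (A : set 'B(H)) (pi : 'B(H) -> 'B(K)) S T :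
  linear_on A pi -> A S -> A T -> pi (S + T) = pi S + pi T.
Proof. by move=> pl AS AT; rewrite -[S]scale1r pl// !scale1r. Qed.

Lemma linear_on_sum H K (A : set 'B(H)) (pi : 'B(H) -> 'B(K)) (I : finType)
    (F : I -> 'B(H)) : Defs.subspace A -> linear_on A pi -> (forall i, A (F i)) ->
  pi (\sum_i F i) = \sum_i pi (F i).
Proof.
move=> sA pl AF.
pose P (x : 'B(H)) (y : 'B(K)) := A x /\ pi x = y.
suff : P (\sum_i F i) (\sum_i pi (F i)) by case.
apply: (big_ind2 P) => //; first by split; [case: sA|exact: linear_on0 pl].
move=> S S' T T' [AS <-] [AT <-]; split; first exact: subspaceD.
exact: (linear_onD pl).
Qed.

Lemma block_adjoint (I : choiceType) H (S T : 'B(ell2 I H)) i j :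
  is_adjoint S T -> is_adjoint (block S i j) (block T j i).
Proof.
by move=> ST x y; rewrite !blockE -inner_tens_delta -ST inner_tens_deltar.
Qed.

(** Applied entrywise, pi is again a *-homomorphism, on the norm-closed algebra
    of the matrices with entries in A; so star_hom_ge0 suffices. *)
Lemma star_hom_cp H K (A : set 'B(H)) (pi : 'B(H) -> 'B(K)) :
  norm_closed_algebra A -> star_hom A pi -> completely_positive_on A pi.
Proof.
move=> nA pA n M AM M0.
have sA := nca_subspace nA; have pl := sh_linear pA.
pose AA := [set T : 'B(ell2 'I_n H) | forall i j, A (block T i j)].
pose Pi (T : 'B(ell2 'I_n H)) := mxop (fun i j => pi (block T i j)).
have blockL a (S T : 'B(ell2 'I_n H)) i j :
    block (a *: S + T) i j = a *: block S i j + block T i j.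
  by apply: bop_eqP => x.
have nAA : norm_closed_algebra AA.
  split.
  - by move=> i j; rewrite block1; case: ifP => _; [exact: nca_one|case: sA].
  - split=> [i j|a S T AS AT i j].
      by rewrite (_ : block _ _ _ = 0); [case: sA|exact: bop_eqP].
    by rewrite blockL; apply: subspaceD => //; apply: subspaceZ.
  - move=> S T AS AT i j; rewrite block_mul; apply: subspace_sum => // k.
    by apply: (nca_mul nA).
  - move=> u T Au uT i j.
    apply: (nca_closed nA (u := fun N => block (u N) i j)) => [N|]; first exact: Au.
    exact: op_cvg_comp.
have sPi : star_hom AA Pi.
  split.
  - move=> a S T AS AT; apply: bop_eqP => v; apply: ell2_eqP => i.
    rewrite bopDE bopZE ell2DE ell2ZE !mxopE scaler_sumr -big_split/=.
    by apply: eq_bigr => j _; rewrite blockL pl.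
  - apply: bop_eqP => v; apply: ell2_eqP => i; rewrite mxopE (bigD1 i)// block1 eqxx.
    rewrite (sh_one pA) big1 => [|k /andP[_ ki]]; first exact: addr0.
    by rewrite block1 eq_sym (negbTE ki) (linear_on0 sA pl).
  - move=> S T AS AT; apply: bop_eqP => v; apply: ell2_eqP => i.
    rewrite bopME !mxopE.
    under [RHS]eq_bigr do rewrite mxopE linear_sum.
    rewrite exchange_big; apply: eq_bigr => j _.
    rewrite block_mul (linear_on_sum sA pl) => [|k]; last exact: nca_mul.
    by rewrite bop_sumE; apply: eq_bigr => k _; rewrite (sh_mul pA).
  - move=> S T AS AT ST v w; rewrite [RHS]inner_conj !inner_mxop rmorph_sum exchange_big/=.
    apply: eq_bigr => i _; rewrite rmorph_sum; apply: eq_bigr => j _ /=.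
    rewrite -inner_conj; apply: (sh_adjoint pA) => //.
    exact: block_adjoint.
have := star_hom_ge0 nAA sPi (X := mxop M).
have -> : Pi (mxop M) = mxop (fun i j => map_mx pi M i j).
  by rewrite /Pi; congr mxop; apply/funext => i; apply/funext => j; rewrite block_mxop mxE.
move=> h; apply/mxop_ge0P/h; last exact/mxop_ge0P.
by move=> i j; rewrite block_mxop.
Qed.

(** Reindexing by an arbitrary finite type, so that bool and products can index
    the matrices below. *)
Lemma cp_fin H K (E : set 'B(K)) (phi : 'B(K) -> 'B(H)) (I : finType)
    (M : I -> I -> 'B(K)) :
  completely_positive_on E phi -> (forall i j, E (M i j)) ->
  (forall v : I -> K, 0 <= \sum_i \sum_j inner (M i j (v j)) (v i)) ->
  forall v : I -> H, 0 <= \sum_i \sum_j inner (phi (M i j) (v j)) (v i).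
Proof.
move=> cp EM M0 v.
have re (W : hilbertType R) (F : I -> I -> 'B(W)) (w : I -> W) :
    \sum_i \sum_j inner (F i j (w j)) (w i) =
    \sum_(i < #|I|) \sum_(j < #|I|)
      inner (F (enum_val i) (enum_val j) (w (enum_val j))) (w (enum_val i)).
  rewrite (reindex _ (onW_bij _ (enum_val_bij I)))/=.
  by apply: eq_bigr => i _; rewrite (reindex _ (onW_bij _ (enum_val_bij I)))/=.
pose M' := \matrix_(i < #|I|, j < #|I|) M (enum_val i) (enum_val j).
rewrite re.
have := cp _ M' (fun i j => _) _ (fun i => v (enum_val i)).
move=> /(_ _ _)/le_trans; apply.
- by move=> i j; rewrite mxE.
- move=> w; have := M0 (w \o enum_rank); rewrite re; congr (0 <= _).
  by apply: eq_bigr => i _; apply: eq_bigr => j _; rewrite mxE /= !enum_valK.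
- by under eq_bigr do under eq_bigr do rewrite !mxE.
Qed.

(** The quadratic form at (v, w) of the 2 x 2 matrix with k on the diagonal and
    T, S above and below it. For S = T^*, it is nonnegative exactly when the
    norm of T is at most k, which encodes norms in terms of positivity. *)
Definition two_block_form H (k : R) (S T : 'B(H)) v w : R[i] :=
  (k * rnorm v ^+ 2)%:C + inner (T w) v + (inner (S v) w + (k * rnorm w ^+ 2)%:C).

Lemma two_block_formE H (k : R) (S T : 'B(H)) v w : is_adjoint T S ->
  two_block_form k S T v w =
  (k * rnorm v ^+ 2 + k * rnorm w ^+ 2 + 2 * complex.Re (inner v (T w)))%:C.
Proof.
move=> TS; rewrite /two_block_form [inner (S v) w]inner_conj -TS [inner v _]inner_conj.
case: (inner (T w) v) => a b; apply/eqP; rewrite eq_complex/=.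
by apply/andP; split; apply/eqP; ring.
Qed.

(** The form dominates k |v + k^-1 T w|^2. *)
Lemma two_block_form_ge0 H (k : R) (S T : 'B(H)) v w : is_adjoint T S -> 0 < k ->
  (forall u, rnorm (T u) <= k * rnorm u) -> 0 <= two_block_form k S T v w.
Proof.
move=> TS k0 Tk; have kVN : k * k^-1 = 1 by rewrite divff// gt_eqF.
have h : 0 <= k * rnorm (v + k^-1%:C *: T w) ^+ 2 by rewrite mulr_ge0 ?sqr_ge0 ?ltW.
rewrite two_block_formE// ler0c (le_trans h)// rnorm_sqrD rnormZr Re_innerZr.
rewrite ger0_norm ?invr_ge0 ?(ltW k0)//.
have := Tk w; have := rnorm_ge0 (T w); have := rnorm_ge0 w.
move: (rnorm (T w)) (rnorm w) (rnorm v) (complex.Re _) => t u s c u0 t0 tu.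
have t2 : t ^+ 2 <= k ^+ 2 * u ^+ 2.
  by rewrite -exprMn ler_pXn2r// nnegrE mulr_ge0 ?(ltW k0).
have : k * (k^-1 * t) ^+ 2 <= k * u ^+ 2.
  by rewrite ler_wpM2l ?(ltW k0)// exprMn exprVn ler_pdivrMl// exprn_gt0.
rewrite !mulrDr [k * (2 * _)]mulrCA [k * (k^-1 * c)]mulrA kVN mul1r => ?; lra.
Qed.

Section UnitalCP.
Context {H K : hilbertType R} (E : set 'B(K)) (phi : 'B(K) -> 'B(H)).
Hypotheses (Esys : operator_system E) (philin : linear_on E phi)
  (phicp : completely_positive_on E phi) (phi1 : phi 1 = 1).

Let E1 : E 1. Proof. by case: Esys. Qed.
Let Esub : Defs.subspace E. Proof. by case: Esys. Qed.

Let phi_form k S T : E S -> E T -> (forall v w, 0 <= two_block_form k S T v w) ->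
  forall v w, 0 <= two_block_form k (phi S) (phi T) v w.
Proof.
move=> ES ET Q0 v w.
pose M (a b : bool) : 'B(K) :=
  if a == b then k%:C *: (1 : 'B(K)) else if a then T else S.
have EM a b : E (M a b).
  by rewrite /M; case: ifP => _; [exact: subspaceZ|case: ifP].
have form (W : hilbertType R) (psi : 'B(K) -> 'B(W)) (u : bool -> W) :
    psi (k%:C *: (1 : 'B(K))) = k%:C *: (1 : 'B(W)) ->
    \sum_a \sum_b inner (psi (M a b) (u b)) (u a) =
    two_block_form k (psi S) (psi T) (u true) (u false).
  move=> psi1; rewrite !big_bool /M /= psi1 !bopZE !bop1E !innerZl !inner_rnormE.
  by rewrite -!rmorphM.
have := cp_fin phicp EM _ (fun b => if b then v else w).
rewrite form; last by rewrite (linear_onZ _ Esub philin E1) phi1.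
by apply => u; have := @form K id u; rewrite /= => -> //; exact: Q0.
Qed.

(** The form of the image matrix is real for all v and w; replacing v by i v
    separates the real and the imaginary part. *)
Lemma ucp_adjoint S T : E S -> E T -> is_adjoint T S -> is_adjoint (phi T) (phi S).
Proof.
move=> ES ET TS.
pose k := opnorm T + 1.
have k0 : 0 < k by rewrite ltr_wpDl// opnorm_ge0.
have Tk v : rnorm (T v) <= k * rnorm v.
  by rewrite (le_trans (rnorm_opnorm _ _))// ler_wpM2r ?rnorm_ge0// lerDl.
have q := phi_form ES ET (fun v w => two_block_form_ge0 v w TS k0 Tk).
have im v w : complex.Im (inner (phi T w) v) + complex.Im (inner (phi S v) w) = 0.
  have := q v w; rewrite /two_block_form.
  case: (inner _ _) (inner _ _) => a b [c d].
  by rewrite lecE /= => /andP[/eqP + _]; rewrite addr0 add0r.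
move=> w v; rewrite [RHS]inner_conj.
have := im v w; have := im ('i *: v) w; rewrite linearZ/= innerZr innerZl.
case: (inner (phi T w) v) (inner (phi S v) w) => a b [c d] /= h1 h2.
by congr Complex; lra.
Qed.

(** The form of the image matrix at v = - k^-1 phi(T) w equals
    (k^2 |w|^2 - |phi(T) w|^2) / k. *)
Lemma ucp_contractive T (k : R) : E T -> 0 <= k ->
  (forall v, rnorm (T v) <= k * rnorm v) -> forall v, rnorm (phi T v) <= k * rnorm v.
Proof.
move=> ET k0 Tk w; apply/ler_addgt0Pr => e e0.
have [S TS] := adjoint_ex T.
have ES : E S by case: Esys => _ _ Est; exact: Est TS.
have w1 : 0 < rnorm w + 1 by rewrite ltr_wpDl// rnorm_ge0.
(* k may be 0, so it is replaced by k + d with d |w| <= e. *)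
pose d := e / (rnorm w + 1).
have d0 : 0 < d by rewrite divr_gt0.
have kd0 : 0 < k + d by rewrite ltr_wpDl.
have Tkd v : rnorm (T v) <= (k + d) * rnorm v.
  by rewrite (le_trans (Tk v))// ler_wpM2r ?rnorm_ge0// lerDl ltW.
have := phi_form ES ET (fun v w => two_block_form_ge0 v w TS kd0 Tkd)
  ((- (k + d)^-1)%:C *: phi T w) w.
rewrite two_block_formE; last exact: ucp_adjoint.
rewrite ler0c rnormZr Re_innerZl -rnorm_sqr_inner normrN ger0_norm ?invr_ge0 ?(ltW kd0)//.
rewrite exprMn.
have -> : (k + d) * ((k + d)^-1 ^+ 2 * rnorm (phi T w) ^+ 2) + (k + d) * rnorm w ^+ 2 +
    2 * (- (k + d)^-1 * rnorm (phi T w) ^+ 2) =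
    (((k + d) * rnorm w) ^+ 2 - rnorm (phi T w) ^+ 2) / (k + d).
  by field; rewrite gt_eqF.
rewrite pmulr_lge0 ?invr_gt0// subr_ge0 ler_pXn2r ?nnegrE ?mulr_ge0 ?rnorm_ge0 ?(ltW kd0)//.
move=> /le_trans; apply; rewrite mulrDl lerD2l /d mulrAC ler_pdivrMr//.
by rewrite ler_wpM2l ?(ltW e0)// lerDl.
Qed.

End UnitalCP.
End CompletelyPositive.

(** * Ultra-weak closures and bimodularity *)

Section UltraweakClosure.
Context {R : realType}.
Implicit Types H K L : hilbertType R.

Lemma ell2_rnorm_le (I : choiceType) H K (f : ell2 I H) (g : ell2 I K) (M : R) :
  0 <= M -> (forall i, rnorm (f i) <= M * rnorm (g i)) -> rnorm f <= M * rnorm g.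
Proof.
move=> M0 fg; rewrite -(ler_pXn2r (n := 2))// ?nnegrE ?mulr_ge0 ?rnorm_ge0//.
rewrite exprMn !ell2_rnorm_sqr; apply: ell2_normsq_le => J.
apply: (@le_trans _ _ (\sum_(i <- J) M ^+ 2 * rnorm (g i) ^+ 2)).
  apply: ler_sum => i _; rewrite -exprMn.
  by rewrite ler_pXn2r// nnegrE ?mulr_ge0 ?rnorm_ge0.
by rewrite -mulr_sumr ler_wpM2l ?sqr_ge0// ell2_normsq_ge.
Qed.

Lemma diag_op_le (I : choiceType) H (d : I -> 'B(H)) (M : R) (f : ell2 I H) :
  0 <= M -> (forall g x, rnorm (d g x) <= M * rnorm x) ->
  rnorm (diag_op d f) <= M * rnorm f.
Proof. by move=> M0 dM; apply: ell2_rnorm_le => // i; rewrite (diag_opE dM). Qed.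

(** The functional of T at (xi, eta) is the inner product of the amplification
    of T, applied to xi, with eta. *)
Lemma uw_functional_le H (xi eta : ell2 nat H) (T : 'B(H)) (M : R) : 0 <= M ->
  (forall x, rnorm (T x) <= M * rnorm x) ->
  `|uw_functional xi eta T| <= (M * (rnorm xi * rnorm eta))%:C.
Proof.
move=> M0 TM.
have -> : uw_functional xi eta T = inner (diag_op (fun=> T) xi) eta.
  by congr csum; apply/funext => n; rewrite (diag_opE (fun=> TM)).
rewrite (le_trans (inner_CS _ _))// lecR mulrA ler_wpM2r ?rnorm_ge0//.
exact: diag_op_le.
Qed.

(** Ultra-weak functionals are continuous in norm. A neighbourhood involves
    finitely many of them, and c bounds all their norms. *)
Lemma op_cvg_uw_closure H (E : set 'B(H)) (u : nat -> 'B(H)) T :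
  (forall N, E (u N)) -> op_cvg u T -> uw_closure E T.
Proof.
move=> Eu [r r0 uT] n xi eta e e0.
pose c := \sum_k rnorm (xi k) * rnorm (eta k).
have ck k : rnorm (xi k) * rnorm (eta k) <= c.
  by rewrite /c (bigD1 k)//= lerDl sumr_ge0// => i _; rewrite mulr_ge0 ?rnorm_ge0.
have c0 : 0 <= c by rewrite sumr_ge0// => i _; rewrite mulr_ge0 ?rnorm_ge0.
have c1 : 0 < c + 1 by rewrite ltr_wpDl.
have ec : 0 < e / (c + 1) by rewrite divr_gt0.
move/cvgrPdist_lt : r0 => /(_ _ ec)[N _ /(_ N (leqnn _))].
rewrite sub0r normrN => rN.
exists (u N) => // k; apply: (@le_lt_trans _ _ (`|r N| * (rnorm (xi k) * rnorm (eta k)))%:C).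
  apply: uw_functional_le => // x; rewrite bopDE bopNE rnormB (le_trans (uT _ _))//.
  by rewrite ler_wpM2r ?rnorm_ge0// ler_norm.
rewrite ltcR; apply: (@le_lt_trans _ _ (`|r N| * c)); first by rewrite ler_wpM2l.
rewrite ltr_pdivlMr// in rN; apply: le_lt_trans rN.
by rewrite ler_wpM2l// lerDl.
Qed.

Lemma von_neumann_norm_closed H (A : set 'B(H)) :
  von_neumann_algebra A -> norm_closed_algebra A.
Proof.
case=> A1 sA Am As Ac; split=> // u T Au uT; apply: Ac.
exact: op_cvg_uw_closure uT.
Qed.

Lemma lspan_subspace (V : lmodType R[i]) (S : set V) : Defs.subspace (lspan S).
Proof.
split.
  by exists 0%N, (fun=> 0), (fun=> 0); split; [case|rewrite big_ord0].
move=> a _ _ [n [c [F [SF ->]]]] [m [d [F' [SF' ->]]]].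
exists (n + m)%N.
exists (fun i => match fintype.split i with inl j => a * c j | inr k => d k end).
exists (fun i => match fintype.split i with inl j => F j | inr k => F' k end).
split=> [i|]; first by case: (fintype.split i).
rewrite big_split_ord/= scaler_sumr; congr (_ + _); apply: eq_bigr => i _.
  by rewrite (unsplitK (inl i)) scalerA.
by rewrite (unsplitK (inr i)).
Qed.

Lemma sub_lspan (V : lmodType R[i]) (S : set V) : S `<=` lspan S.
Proof.
move=> T ST; exists 1%N, (fun=> 1), (fun=> T); split=> //.
by rewrite big_ord1 scale1r.
Qed.

Lemma setT_operator_system H : operator_system (@setT 'B(H)).
Proof. by split. Qed.

Section Bimodular.
Context {H : hilbertType R} (A : set 'B(H)) (phi : 'B(H) -> 'B(H)).
Hypotheses (Astar : star_closed A) (A1 : A 1)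
  (Amul : forall S T, A S -> A T -> A (S * T)) (philin : linear_on setT phi)
  (phicp : completely_positive_on setT phi) (phiA : forall a, A a -> phi a = a).

Lemma setT_cp_adjoint S T : is_adjoint T S -> is_adjoint (phi T) (phi S).
Proof. by apply: (ucp_adjoint (setT_operator_system H)) => //; exact: phiA. Qed.

(** The Gram matrix of (1, a, x), with entries Y_i^* Y_j, is positive; so is its
    image under phi. The vector (- a v, v) is in the kernel of the upper left
    2 x 2 corner, which phi fixes, hence the off-diagonal part vanishes against
    it; this part is <phi (b x) w - b (phi x) w, v>. *)
Let ucp_modular_adj a b x : A a -> is_adjoint a b -> phi (b * x) = b * phi x.
Proof.
move=> Aa ab; have Ab := Astar Aa ab.
have [y xy] := adjoint_ex x.
have pxy := setT_cp_adjoint xy.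
have bxya : is_adjoint (b * x) (y * a).
  by move=> v w; rewrite !bopME -xy (is_adjoint_sym ab).
have pbxya := setT_cp_adjoint bxya.
pose Y (i : 'I_3) := nth 1 [:: 1; a; x] i.
pose Z (i : 'I_3) := nth 1 [:: 1; b; y] i.
have YZ i : is_adjoint (Y i) (Z i).
  by case: i => -[|[|[|//]]] /=.
have g0 (v : 'I_3 -> H) : 0 <= \sum_i \sum_j inner ((Z i * Y j) (v j)) (v i).
  rewrite (_ : \sum_i _ = inner (\sum_i Y i (v i)) (\sum_i Y i (v i))).
    by rewrite inner_rnormE ler0c sqr_ge0.
  rewrite inner_sumr; apply: eq_bigr => i _; rewrite inner_suml; apply: eq_bigr => j _.
  by rewrite bopME (is_adjoint_sym (YZ i)).
pose z v w := inner (phi (b * x) w - b (phi x w)) v.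
have key v w s : 0 <= 0 + 2 * s * complex.Re (z v w) +
    s ^+ 2 * complex.Re (inner (phi (y * x) w) w).
  have := cp_fin phicp (fun _ _ => I) g0 (fun i => nth 0 [:: - a v; v; s%:C *: w] i).
  rewrite !big_ord_recl !big_ord0 /Y /Z /=.
  rewrite !(mul1r, mulr1) (phiA A1) (phiA Aa) (phiA Ab) (phiA (Amul Ab Aa)).
  rewrite bop1E bopME !linearN !linearZ/= !innerNl !innerNr !addr0 lecE => /andP[_].
  rewrite !(raddfD, raddfN)/= !(Re_innerZl, Re_innerZr).
  have e1 : inner (b (phi x w)) v = inner (phi x w) (a v) by rewrite (is_adjoint_sym ab).
  have e2 : complex.Re (inner (phi y (a v)) w) = complex.Re (inner (phi x w) (a v)).
    by rewrite Re_inner_sym -pxy.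
  have e3 : complex.Re (inner (phi (y * a) v) w) = complex.Re (inner (phi (b * x) w) v).
    by rewrite Re_inner_sym -pbxya.
  rewrite e2 e3 /z innerBl raddfB/= e1 => h; lra.
have re v w : complex.Re (z v w) = 0.
  have h : (complex.Re (z v w)) ^+ 2 <= 0 * complex.Re (inner (phi (y * x) w) w).
    apply: quadratic_ge0 => [|s]; last exact: key.
    by have := key 0 w 1; rewrite /z inner0r mulr0 !add0r expr1n mul1r.
  by apply/eqP; rewrite -sqrf_eq0 eq_le sqr_ge0 andbT; rewrite mul0r in h.
apply: (@bop_eqP R H H) => w; apply/eqP; rewrite -subr_eq0; apply/eqP/rnorm_eq0/eqP.
by rewrite -sqrf_eq0 rnorm_sqr_inner re.
Qed.

Lemma ucp_mull a x : A a -> phi (a * x) = a * phi x.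
Proof.
move=> Aa; have [b ab] := adjoint_ex a.
exact: (ucp_modular_adj x (Astar Aa ab) (is_adjoint_sym ab)).
Qed.

Lemma ucp_mulr a x : A a -> phi (x * a) = phi x * a.
Proof.
move=> Aa; have [b ab] := adjoint_ex a; have [y xy] := adjoint_ex x.
apply: (@is_adjoint_unique _ _ (phi (b * y))).
  apply: setT_cp_adjoint => v w.
  by rewrite !bopME (is_adjoint_sym ab) (is_adjoint_sym xy).
rewrite ucp_mull; last exact: Astar ab.
have pxy := setT_cp_adjoint xy.
by move=> v w; rewrite !bopME (is_adjoint_sym ab) (is_adjoint_sym pxy).
Qed.

End Bimodular.
End UltraweakClosure.

(** * Covariance of the representation Psi *)

Section Covariance.
Context {R : realType} {H : hilbertType R} {G : groupType}.
Implicit Types (g h : G) (x : 'B(ell2 G H)).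

Lemma csum_reindex (f : G -> R[i]) (t : G -> G) : bijective t ->
  csum (f \o t) = csum f.
Proof.
move=> bt.
have sb : set_bij [set: G] [set: G] t.
  by case: bt => t' tK t'K; split=> [//|a b _ _ /(can_inj tK)//|a _]; exists (t' a).
have rs (u : G -> R) : rsum (u \o t) = rsum u.
  rewrite /rsum; congr (fine (_ - _)); rewrite [in RHS](@reindex_esum _ _ _ _ _ _ _ sb);
  by apply: eq_esum => i _; rewrite ?funeposE ?funenegE.
congr Complex; first exact: (rs (fun i => complex.Re (f i))).
exact: (rs (fun i => complex.Im (f i))).
Qed.

Lemma translationM g h :
  translation g * translation h = translation (g * h)%g :> 'B(ell2 G H).
Proof.
by apply: bop_eqP => f; apply: ell2_eqP => k; rewrite bopME !translationE invgM mulgA.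
Qed.

Lemma translation1 : translation 1%g = 1 :> 'B(ell2 G H).
Proof. by apply: bop_eqP => f; apply: ell2_eqP => k; rewrite translationE invg1 mul1g. Qed.

Lemma translation_adjoint g : is_adjoint (translation g : 'B(ell2 G H)) (translation g^-1).
Proof.
move=> f h; pose F k := inner (translation g f k) (h k).
have bij : bijective (fun k => g * k)%g.
  by exists (fun k => g^-1 * k)%g; [exact: mulKg|exact: mulVKg].
rewrite -[LHS]/(csum F) -(csum_reindex F bij); congr csum; apply/funext => k.
by rewrite /F/= mulKg invgK.
Qed.

Lemma rnorm_translation g (f : ell2 G H) : rnorm (translation g f) = rnorm f.
Proof.
apply/eqP; rewrite -(eqrXn2 (n := 2))// ?rnorm_ge0//; apply/eqP.
by rewrite !rnorm_sqr_inner translation_adjoint -bopME translationM mulVg translation1.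
Qed.

Lemma rnorm_tens_delta (I : choiceType) (i : I) (v : H) : rnorm (tens_delta i v) = rnorm v.
Proof.
apply/eqP; rewrite -(eqrXn2 (n := 2))// ?rnorm_ge0//; apply/eqP.
by rewrite !rnorm_sqr_inner inner_tens_delta tens_deltaE eqxx.
Qed.

Lemma rnorm_block_le (I : choiceType) (x : 'B(ell2 I H)) i j (M : R) :
  (forall f, rnorm (x f) <= M * rnorm f) -> forall v, rnorm (block x i j v) <= M * rnorm v.
Proof.
move=> xM v; rewrite blockE (le_trans (ell2_coord_le _ _))//.
by rewrite (le_trans (xM _))// rnorm_tens_delta.
Qed.

Lemma rnorm_Diag_le x (M : R) : 0 <= M ->
  (forall f, rnorm (x f) <= M * rnorm f) -> forall f, rnorm (Diag x f) <= M * rnorm f.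
Proof. by move=> M0 xM f; apply: diag_op_le => // g; exact: rnorm_block_le. Qed.

Context (A : set 'B(H)) (alpha : G -> 'B(H) -> 'B(H)).
Hypotheses (A_vn : von_neumann_algebra A) (alpha_action : star_action A alpha).

Let A1 : A 1 := vn_one A_vn.
Let sA : Defs.subspace A := vn_subspace A_vn.

Lemma von_neumann_operator_system : operator_system A.
Proof. by split => //; exact: vn_star. Qed.

Lemma action_mem g r : A r -> A (alpha g r).
Proof.
by move=> Ar; case: alpha_action => aut _ _; case: (aut g) => -[fA _ _] _ _ _; exact: fA.
Qed.

Lemma action1 r : A r -> alpha 1%g r = r.
Proof. by case: alpha_action => _ a1 _; exact: a1. Qed.

Lemma actionM g h r : A r -> alpha (g * h)%g r = alpha g (alpha h r).
Proof. by case: alpha_action => _ _; apply. Qed.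

(** Surjectivity yields that the unit is preserved. *)
Lemma action_star_hom g : star_hom A (alpha g).
Proof.
case: alpha_action => aut _ _; case: (aut g) => -[fA _ surj] lin mul adj; split=> //.
have [e Ae e1] := surj _ A1.
by rewrite -[LHS]mulr1 -{2}e1 -mul// mul1r e1.
Qed.

Lemma rnorm_action_le g r (M : R) : A r -> 0 <= M ->
  (forall v, rnorm (r v) <= M * rnorm v) -> forall v, rnorm (alpha g r v) <= M * rnorm v.
Proof.
have ag := action_star_hom g.
apply: (ucp_contractive von_neumann_operator_system (sh_linear ag) _ (sh_one ag)).
exact: star_hom_cp (von_neumann_norm_closed A_vn) ag.
Qed.

Lemma PsiE r : A r -> forall f g, Psi alpha r f g = alpha g^-1%g r (f g).
Proof.
move=> Ar; apply: (@diag_opE _ _ _ _ (opnorm r)) => g.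
by apply: rnorm_action_le => // [|v]; [exact: opnorm_ge0|exact: rnorm_opnorm].
Qed.

Lemma Psi_star_hom : star_hom A (Psi alpha : 'B(H) -> 'B(ell2 G H)).
Proof.
split.
- move=> a S T AS AT; apply: bop_eqP => f; apply: ell2_eqP => g.
  have AST : A (a *: S + T) by apply: subspaceD => //; exact: subspaceZ.
  by rewrite bopDE bopZE ell2DE ell2ZE !PsiE// (sh_linear (action_star_hom _)).
- apply: bop_eqP => f; apply: ell2_eqP => g.
  by rewrite PsiE// (sh_one (action_star_hom _)).
- move=> S T AS AT; apply: bop_eqP => f; apply: ell2_eqP => g.
  rewrite bopME !PsiE//; last exact: (vn_mul A_vn).
  by rewrite (sh_mul (action_star_hom _)).
- move=> S T AS AT ST f h; congr csum; apply/funext => g.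
  by rewrite !PsiE//; apply: (sh_adjoint (action_star_hom _)).
Qed.

Lemma Psi_cp : completely_positive_on A (Psi alpha : 'B(H) -> 'B(ell2 G H)).
Proof. exact: star_hom_cp (von_neumann_norm_closed A_vn) Psi_star_hom. Qed.

Lemma rnorm_Psi_le r (M : R) : A r -> 0 <= M ->
  (forall v, rnorm (r v) <= M * rnorm v) ->
  forall f, rnorm (Psi alpha r f) <= M * rnorm f.
Proof.
by move=> Ar M0 rM f; apply: diag_op_le => // g; exact: rnorm_action_le.
Qed.

Lemma Psi_covariant g r : A r ->
  translation g * Psi alpha r = Psi alpha (alpha g r) * translation g.
Proof.
move=> Ar; apply: bop_eqP => f; apply: ell2_eqP => h.
rewrite !bopME translationE !PsiE//; last exact: action_mem.
by rewrite translationE -actionM// invgM invgK.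
Qed.

Lemma block_translation_Psi g r s t : A r ->
  block (translation g * Psi alpha r) s t = if s == (g * t)%g then alpha t^-1%g r else 0.
Proof.
move=> Ar; apply: bop_eqP => v; rewrite blockE bopME translationE PsiE// tens_deltaE.
rewrite -(inj_eq (mulgI g)) mulVKg; case: eqP => [->|_]; last by rewrite linear0.
by rewrite mulKg.
Qed.

Lemma block_Psi_mul r x s g h : A r -> A s ->
  block (Psi alpha r * x * Psi alpha s) g h = alpha g^-1%g r * block x g h * alpha h^-1%g s.
Proof.
move=> Ar As; apply: bop_eqP => v.
rewrite blockE !bopME PsiE// blockE; congr (alpha _ r (x _ _)).
apply: ell2_eqP => k; rewrite PsiE// !tens_deltaE; case: eqP => [->//|_].
by rewrite linear0.
Qed.

(** The operator moves the fibre over k to the one over s * t^-1 * k. *)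
Lemma Diag_translation_Psi s t r f : A r -> s <> t ->
  Diag (translation s * Psi alpha r * translation t^-1%g) f = 0.
Proof.
move=> Ar st; apply: ell2_eqP => k.
rewrite DiagE !bopME translationE PsiE// translationE tens_deltaE invgK.
case: eqP => [h|_]; last by rewrite linear0.
case: st; apply: (mulIg (s^-1 * k)%g).
by rewrite h mulVKg.
Qed.

End Covariance.

(** * Weighted double sums and the positive definite function *)

Section SquareSums.
Context {R : realType}.
Implicit Types H K : hilbertType R.

(** Squares are the partial sums for which the terms of a positive definite
    kernel add up to something positive at every stage. *)
Definition square_sum (V : nmodType) (t : nat -> nat -> V) N : V :=
  \sum_(m < N) \sum_(n < N) t m n.

Lemma square_sumS (V : nmodType) (t : nat -> nat -> V) N :
  square_sum t N.+1 =
  square_sum t N + (\sum_(m < N) t m N + (\sum_(n < N) t N n + t N N)).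
Proof.
rewrite /square_sum big_ord_recr/=; under eq_bigr do rewrite big_ord_recr/=.
by rewrite big_split/= big_ord_recr/= -addrA.
Qed.

Lemma rnorm_sum_le H (I : Type) (r : seq I) (P : pred I) (F : I -> H) (c : I -> R) :
  (forall i, P i -> rnorm (F i) <= c i) ->
  rnorm (\sum_(i <- r | P i) F i) <= \sum_(i <- r | P i) c i.
Proof.
move=> Fc; apply: (big_ind2 (fun (x : H) y => rnorm x <= y)) => //.
  by rewrite rnorm0.
by move=> x a y b xa yb; rewrite (le_trans (rnormD _ _))// lerD.
Qed.

Definition weight n : R := 2^-1 ^+ n.+1.

Lemma weight_gt0 n : 0 < weight n.
Proof. by rewrite exprn_gt0// invr_gt0. Qed.

Lemma sum_weight N : \sum_(n < N) weight n = 1 - 2^-1 ^+ N.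
Proof.
elim: N => [|N IH]; first by rewrite big_ord0 expr0 subrr.
by rewrite big_ord_recr/= IH /weight exprSr; field.
Qed.

Lemma square_sum_weight N : square_sum (fun m n => weight m * weight n) N = (1 - 2^-1 ^+ N) ^+ 2.
Proof.
rewrite /square_sum; under eq_bigr do rewrite -mulr_sumr.
by rewrite -mulr_suml !sum_weight.
Qed.

Lemma square_sum_weight_le1 N : square_sum (fun m n => weight m * weight n) N <= 1.
Proof.
rewrite square_sum_weight exprn_ile1// ?subr_ge0 ?lerBlDr ?lerDl ?exprn_ge0 ?invr_ge0//.
by rewrite exprn_ile1 ?invr_ge0// invf_le1// ler1n.
Qed.

Lemma op_cvg_square_sum H K (t : nat -> nat -> bop H K) (M : R) : 0 <= M ->
  (forall m n x, rnorm (t m n x) <= M * rnorm x) ->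
  exists T, op_cvg (square_sum (fun m n => (weight m * weight n)%:C *: t m n)) T.
Proof.
move=> M0 tM.
have w0 m n : 0 <= weight m * weight n by rewrite mulr_ge0 ?ltW ?weight_gt0.
pose a N := M * square_sum (fun m n => weight m * weight n) N.
have aS N : a N.+1 - a N = M * (\sum_(m < N) weight m * weight N +
    (\sum_(n < N) weight N * weight n + weight N * weight N)).
  by rewrite /a square_sumS mulrDr addrAC subrr add0r.
apply: (@op_cvg_ex _ _ _ _ a (M * (1 - 0) ^+ 2)).
- move=> N; rewrite -subr_ge0 aS mulr_ge0// !addr_ge0 ?sumr_ge0//.
- rewrite /a; apply: cvgM; first exact: cvg_cst.
  have -> : square_sum (fun m n => weight m * weight n) =
      fun N => (1 - 2^-1 ^+ N) * (1 - 2^-1 ^+ N) :> R.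
    by apply/funext => N; rewrite square_sum_weight expr2.
  rewrite expr2.
  have h : (fun N => 1 - 2^-1 ^+ N : R) @ \oo --> (1 - 0 : R).
    apply: cvgB; first exact: cvg_cst.
    apply: cvg_expr; rewrite ger0_norm ?invr_ge0// invf_lt1// ltr1n//.
  exact: (cvgM h h).
- move=> N x; rewrite square_sumS aS bopDE addrAC subrr add0r -mulrA [leRHS]mulrC -mulrA.
  have tb m n : rnorm ((weight m * weight n)%:C *: t m n x) <=
      weight m * weight n * (rnorm x * M).
    by rewrite rnormZr ger0_norm// ler_wpM2l// mulrC.
  rewrite !bopDE !bop_sumE mulrDl (le_trans (rnormD _ _))// lerD//.
    by rewrite mulr_suml; apply: rnorm_sum_le => i _; rewrite bopZE.
  rewrite mulrDl (le_trans (rnormD _ _))// lerD// ?bopZE//.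
  by rewrite mulr_suml; apply: rnorm_sum_le => i _; rewrite bopZE.
Qed.

End SquareSums.

Section Coefficient.
Context {R : realType} {G : groupType} (e : nat -> G).
Hypothesis e_surj : forall g, exists n, e n = g.
Implicit Types g : G.

(** Partial sums of the coefficient <lambda_g f, f> of the regular
    representation at f = sum_n weight n * delta_(e n), not yet normalised. *)
Definition coef_partial N g : R :=
  square_sum (fun m n => weight m * weight n * (e m == (g * e n)%g)%:R) N.

Definition coef g : R := lim (coef_partial ^~ g @ \oo).

Let term_ge0 g m n : 0 <= weight m * weight n * (e m == (g * e n)%g)%:R :> R.
Proof. by rewrite !mulr_ge0// ltW// weight_gt0. Qed.

Lemma coef_partial_nd g : nondecreasing_seq (coef_partial ^~ g).
Proof.
apply/nondecreasing_seqP => N; rewrite /coef_partial /= square_sumS lerDl.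
by rewrite !addr_ge0 ?sumr_ge0.
Qed.

Lemma coef_partial_cvg g : coef_partial ^~ g @ \oo --> coef g.
Proof.
apply: nondecreasing_is_cvgn; first exact: coef_partial_nd.
exists 1 => _ [N _ <-]; rewrite (le_trans _ (square_sum_weight_le1 N))//.
apply: ler_sum => m _; apply: ler_sum => n _.
have w0 : 0 <= weight m * weight n :> R by rewrite mulr_ge0 ?ltW ?weight_gt0.
by rewrite -[leRHS]mulr1 ler_wpM2l// lern1 leq_b1.
Qed.

Lemma coef_partial_le N g : coef_partial N g <= coef g.
Proof.
apply: nondecreasing_cvgn_le; first exact: coef_partial_nd.
by apply/cvg_ex; eexists; exact: coef_partial_cvg.
Qed.

Lemma coef_gt0 g : 0 < coef g.
Proof.
have [m em] := e_surj g; have [n en] := e_surj 1%g.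
pose N := (maxn m n).+1.
apply: lt_le_trans (coef_partial_le N g).
have mN : (m < N)%N by rewrite ltnS leq_maxl.
have nN : (n < N)%N by rewrite ltnS leq_maxr.
rewrite /coef_partial /square_sum (bigD1 (Ordinal mN))//= (bigD1 (Ordinal nN))//=.
rewrite em en mulg1 eqxx mulr1 -addrA ltr_pwDl// ?mulr_gt0 ?weight_gt0//.
by rewrite addr_ge0 ?sumr_ge0// => i _; [rewrite -[X in X == _]em|rewrite sumr_ge0].
Qed.

Lemma sum_pair (V : nmodType) (I J : finType) (F : I * J -> V) :
  \sum_p F p = \sum_i \sum_j F (i, j).
Proof. by rewrite pair_bigA; apply: eq_bigr => -[]. Qed.

(** The equality kernel is a Gram matrix: it is the sum over all values h of the
    rank one kernels (p i == h) * (p j == h). *)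
Lemma kernel_ge0 (J : finType) (T : eqType) (p : J -> T) (z : J -> R[i]) :
  0 <= \sum_i \sum_j (z i)^* * z j * (p i == p j)%:R.
Proof.
pose s := undup (map p (enum J)).
have sE i j : (p i == p j)%:R = \sum_(h <- s) (p i == h)%:R * (p j == h)%:R :> R[i].
  have pis : p i \in s by rewrite mem_undup map_f// mem_enum.
  rewrite (bigD1_seq (p i))//= ?undup_uniq// eqxx mul1r eq_sym big1 ?addr0// => h hi.
  by rewrite eq_sym (negbTE hi) mul0r.
have -> : \sum_i \sum_j (z i)^* * z j * (p i == p j)%:R =
    \sum_(h <- s) (\sum_i z i * (p i == h)%:R)^* * (\sum_j z j * (p j == h)%:R).
  under eq_bigr do under eq_bigr do rewrite sE mulr_sumr.
  under eq_bigr do rewrite exchange_big/=.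
  rewrite exchange_big/=; apply: eq_bigr => h _.
  rewrite rmorph_sum mulr_suml; apply: eq_bigr => i _.
  rewrite mulr_sumr; apply: eq_bigr => j _.
  by rewrite rmorphM rmorph_nat mulrACA.
apply: sumr_ge0 => h _; rewrite mulrC -normCK.
by rewrite exprn_ge0.
Qed.

(** The kernel (g_i^-1 g_j e_n == e_m) is the equality kernel of the family
    g_i e_m, indexed by pairs. *)
Lemma coef_positive_definite : positive_definite coef.
Proof.
move=> k g c.
pose F (f : G -> R) := \sum_i \sum_j (c i)^* * c j * (f ((g i)^-1 * g j)%g)%:C.
pose r N := \sum_i \sum_j complex.Re `|(c i)^* * c j| *
  `|coef ((g i)^-1 * g j)%g - coef_partial N ((g i)^-1 * g j)%g|.
apply: (@complex_ge0_lim _ (fun N => F (coef_partial N)) _ r).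
- move=> N.
  pose z (p : 'I_k * 'I_N) := c p.1 * (weight p.2)%:C.
  have := kernel_ge0 (fun p : 'I_k * 'I_N => (g p.1 * e p.2)%g) z.
  rewrite sum_pair; congr (0 <= _); apply: eq_bigr => i _.
  under eq_bigr do rewrite sum_pair.
  rewrite exchange_big/=; apply: eq_bigr => j _.
  rewrite rmorph_sum mulr_sumr; apply: eq_bigr => m _.
  rewrite rmorph_sum mulr_sumr; apply: eq_bigr => n _.
  have wE : Num.conj ((weight m)%:C : R[i]) = (weight m)%:C by exact: conjc_real.
  rewrite /z /= !rmorphM/= rmorph_nat wE -(inj_eq (mulgI (g i)^-1)%g) mulKg mulgA.
  ring.
- move=> N; rewrite /F -sumrB rmorph_sum (le_trans (ler_norm_sum _ _ _))//.
  apply: ler_sum => i _; rewrite -sumrB rmorph_sum (le_trans (ler_norm_sum _ _ _))//.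
  apply: ler_sum => j _; rewrite -mulrBr normrM rmorphM/= -normcE -rmorphB/=.
  by rewrite [X in _ * X <= _]normc_def/= expr0n addr0 sqrtr_sqr.
- rewrite /r.
  have cv0 (a : R) h : (fun N => a * `|coef h - coef_partial N h|) @ \oo --> 0.
    rewrite -(mulr0 a); apply: cvgM; first exact: cvg_cst.
    rewrite -(normr0 R) -(subrr (coef h)); apply: cvg_norm.
    apply: cvgB; [exact: cvg_cst|exact: coef_partial_cvg].
  have sum0 (J : finType) (f : J -> nat -> R) : (forall j, f j @ \oo --> 0) ->
      (fun N => \sum_j f j N) @ \oo --> 0.
    move=> f0; elim: (index_enum J) => [|j s IH].
      by under eq_fun do rewrite big_nil; exact: cvg_cst.
    under eq_fun do rewrite big_cons.
    by have := cvgD (f0 j) IH; rewrite addr0; exact.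
  by apply: (sum0 _ _) => i; apply: sum0 => j; exact: cv0.
Qed.

End Coefficient.

(** * The averaged expectation *)

Section Expectation.
Context {R : realType} {H : hilbertType R} {G : groupType}.
Context (A : set 'B(H)) (alpha : G -> 'B(H) -> 'B(H)) (E : 'B(H) -> 'B(H)).
Context (e : nat -> G).
Hypotheses (A_vn : von_neumann_algebra A) (alpha_action : star_action A alpha).
Hypotheses (E_lin : linear_on setT E) (E_cp : completely_positive_on setT E)
  (E_mem : forall T, A (E T)) (E_id : forall T, A T -> E T = T).
Implicit Types (x : 'B(ell2 G H)) (N m n : nat) (g : G).

Let sA : Defs.subspace A := vn_subspace A_vn.
Let sh : star_hom A (Psi alpha : 'B(H) -> 'B(ell2 G H)) := Psi_star_hom A_vn alpha_action.

Definition corner x m n : 'B(ell2 G H) :=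
  translation (e m) * Psi alpha (E (block x (e m) (e n))) * translation (e n)^-1%g.

Definition average_partial N x : 'B(ell2 G H) :=
  square_sum (fun m n => (weight m * weight n)%:C *: corner x m n) N.

Lemma rnorm_corner_le x m n f : rnorm (corner x m n f) <= opnorm x * rnorm f.
Proof.
rewrite /corner !bopME rnorm_translation -(rnorm_translation (e n)^-1%g f).
have x0 := opnorm_ge0 x.
apply: (rnorm_Psi_le A_vn alpha_action) => //.
have E1 : E 1 = 1 by apply: E_id; exact: (vn_one A_vn).
apply: (ucp_contractive (setT_operator_system H) E_lin E_cp E1) => //.
by apply: rnorm_block_le; exact: rnorm_opnorm.
Qed.

Let linear_square_sum (V : lmodType R[i]) (t : 'B(ell2 G H) -> nat -> nat -> V) N :
  (forall m n, linear (fun x => t x m n)) -> linear (fun x => square_sum (t x) N).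
Proof.
move=> tl a x y; rewrite /square_sum scaler_sumr -big_split/=; apply: eq_bigr => m _.
by rewrite scaler_sumr -big_split/=; apply: eq_bigr => n _; rewrite tl.
Qed.

Lemma average_partial_linear N : linear (average_partial N).
Proof.
apply: linear_square_sum => m n a x y.
rewrite (_ : corner (a *: x + y) m n = a *: corner x m n + corner y m n).
  by rewrite scalerDr !scalerA mulrC.
have bE : block (a *: x + y) (e m) (e n) = a *: block x (e m) (e n) + block y (e m) (e n).
  by apply: bop_eqP => v.
apply: bop_eqP => f.
rewrite /corner bE E_lin// (sh_linear sh)// bopDE bopZE !bopME bopDE bopZE.
by rewrite linearP.
Qed.

(** Moving the translations to the vectors shows the form of the averaged
    matrix as the form of a larger matrix, indexed by pairs (i, m), with
    entries rho (block (M i j) (e m) (e n)), evaluated at the vectors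
    weight m *: L_(e m)^-1 v_i. *)
Lemma average_partial_cp N (I : finType) (M : I -> I -> 'B(ell2 G H)) :
  op_ge0 (mxop M) -> op_ge0 (mxop (fun i j => average_partial N (M i j))).
Proof.
move=> /mxop_ge0P M0; apply/mxop_ge0P => v.
pose rho T : 'B(ell2 G H) := Psi alpha (E T).
have rho_cp : completely_positive_on setT rho.
  move=> n X _ X0; rewrite /rho.
  have -> : map_mx (fun T => Psi alpha (E T) : 'B(ell2 G H)) X =
      map_mx (Psi alpha : 'B(H) -> 'B(ell2 G H)) (map_mx E X).
    by apply/matrixP => i j; rewrite !mxE.
  by apply: (Psi_cp A_vn alpha_action) => [i j|]; [rewrite mxE|exact: E_cp].
pose X (p q : I * 'I_N) := block (M p.1 q.1) (e p.2) (e q.2).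
have X0 (u : I * 'I_N -> H) : 0 <= \sum_p \sum_q inner (X p q (u q)) (u p).
  have := M0 (fun i => \sum_m tens_delta (e (m : 'I_N)) (u (i, m))).
  rewrite sum_pair.
  congr (0 <= _); apply: eq_bigr => i _.
  under [RHS]eq_bigr do rewrite sum_pair.
  rewrite [RHS]exchange_big/=; apply: eq_bigr => j _.
  rewrite inner_sumr; apply: eq_bigr => m _.
  rewrite linear_sum inner_suml; apply: eq_bigr => n _.
  exact: inner_tens_deltar.
pose u (p : I * 'I_N) := (weight p.2)%:C *: translation (e p.2)^-1%g (v p.1).
have := cp_fin rho_cp (fun _ _ => Logic.I) X0 u.
rewrite sum_pair.
congr (0 <= _); apply: eq_bigr => i _.
under eq_bigr do rewrite sum_pair.
rewrite exchange_big/=; apply: eq_bigr => j _.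
rewrite /average_partial /square_sum bop_sumE inner_suml; apply: eq_bigr => m _.
rewrite bop_sumE inner_suml; apply: eq_bigr => n _.
rewrite bopZE [RHS]innerZl /corner !bopME translation_adjoint.
rewrite [u (j, n)]/u [u (i, m)]/u [rho _ _]linearZ [LHS]innerZl innerZr.
rewrite rmorphM -mulrA mulrCA; congr (_ * (_ * _)).
exact: conjc_real.
Qed.

Lemma average_partial_bimodular N r s x : A r -> A s ->
  average_partial N (Psi alpha r * x * Psi alpha s) =
  Psi alpha r * average_partial N x * Psi alpha s.
Proof.
move=> Ar As; rewrite /average_partial /square_sum mulr_sumr mulr_suml.
apply: eq_bigr => m _; rewrite mulr_sumr mulr_suml; apply: eq_bigr => n _.
rewrite (_ : corner _ m n = Psi alpha r * corner x m n * Psi alpha s).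
  by apply: bop_eqP => f; rewrite !(bopME, bopZE) linearZ.
have [As_ Am] := (vn_star A_vn, vn_mul A_vn).
have Ag g t : A t -> A (alpha g t) by exact: action_mem alpha_action g t.
rewrite /corner (block_Psi_mul A_vn alpha_action)//.
rewrite (ucp_mulr As_ (vn_one A_vn) Am)//; last exact: Ag.
rewrite (ucp_mull As_ (vn_one A_vn) Am)//; last exact: Ag.
have shM := sh_mul sh.
rewrite !shM//; [|exact: Ag|apply: Am => //; exact: Ag|exact: Ag].
rewrite !mulrA (Psi_covariant A_vn alpha_action); last exact: Ag.
rewrite -(actionM alpha_action)// mulgV (action1 alpha_action)//.
rewrite -!mulrA; do 3 congr (_ * _).
rewrite (Psi_covariant A_vn alpha_action) //.
Qed.

(** Only the pairs with e m = g * e n see a nonzero block, and each of them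
    reproduces the operator. *)
Lemma average_partial_fourier N g r : A r ->
  average_partial N (translation g * Psi alpha r) =
  (coef_partial e N g)%:C *: (translation g * Psi alpha r).
Proof.
move=> Ar; rewrite /average_partial /coef_partial /square_sum.
rewrite rmorph_sum scaler_suml; apply: eq_bigr => m _.
rewrite rmorph_sum scaler_suml; apply: eq_bigr => n _.
rewrite /corner (block_translation_Psi A_vn alpha_action)//.
case: eqP => [->|_]; last first.
  rewrite mulr0 rmorph0 scale0r (linear_on0 _ E_lin); last by split.
  by rewrite (linear_on0 sA (sh_linear sh)) mulr0 mul0r scaler0.
rewrite mulr1 E_id; last exact: action_mem alpha_action _ _ Ar.
congr (_ *: _); rewrite -translationM -[X in X * _]mulrA.
rewrite (Psi_covariant A_vn alpha_action); last exact: action_mem alpha_action _ _ Ar.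
rewrite -(actionM alpha_action)// mulgV (action1 alpha_action)//.
by rewrite -!mulrA translationM mulgV translation1 mulr1.
Qed.

Lemma average_partial_mem N x :
  lspan [set translation g * Psi alpha r | g in setT & r in A] (average_partial N x).
Proof.
have sL := lspan_subspace [set translation g * Psi alpha r | g in setT & r in A].
apply: subspace_sum => // m; apply: subspace_sum => // n; apply: subspaceZ => //.
apply: sub_lspan.
exists (e m * (e n)^-1)%g => //; exists (alpha (e n) (E (block x (e m) (e n)))).
  exact: action_mem alpha_action _ _ _.
rewrite -translationM -mulrA (Psi_covariant A_vn alpha_action); last first.
  exact: action_mem alpha_action _ _ _.
by rewrite -(actionM alpha_action)// mulVg (action1 alpha_action)// mulrA.
Qed.

(** Off the pairs with e m = g * e n the diagonal vanishes; the weights of these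
    pairs add up to the coefficient at g. *)
Lemma rnorm_Diag_average_partial N x g f :
  rnorm (Diag (translation g^-1%g * average_partial N x) f) <=
  coef e g * opnorm x * rnorm f.
Proof.
have -> : Diag (translation g^-1%g * average_partial N x) f =
    square_sum (fun m n => (weight m * weight n)%:C *:
      Diag (translation g^-1%g * corner x m n) f) N.
  apply: ell2_eqP => k; rewrite DiagE bopME /average_partial /square_sum.
  rewrite bop_sumE linear_sum !ell2_sumE; apply: eq_bigr => m _.
  rewrite bop_sumE linear_sum !ell2_sumE; apply: eq_bigr => n _.
  by rewrite bopZE linearZ !ell2ZE DiagE.
apply: (@le_trans _ _ (coef_partial e N g * (opnorm x * rnorm f))); last first.
  by rewrite -mulrA ler_wpM2r ?mulr_ge0 ?opnorm_ge0 ?rnorm_ge0// coef_partial_le.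
rewrite mulr_suml; apply: rnorm_sum_le => m _.
rewrite mulr_suml; apply: rnorm_sum_le => n _.
have w0 : 0 <= weight m * weight n :> R by rewrite mulr_ge0// ltW// weight_gt0.
rewrite rnormZr ger0_norm// -mulrA ler_wpM2l//; case: eqP => [_|/eqP ne].
  rewrite mul1r; apply: rnorm_Diag_le; first exact: opnorm_ge0.
  by move=> h; rewrite bopME rnorm_translation; exact: rnorm_corner_le.
rewrite mul0r /corner !mulrA translationM (Diag_translation_Psi A_vn alpha_action) ?rnorm0//.
by move=> h; case/eqP: ne; rewrite -h mulVKg.
Qed.

Lemma average_ex x : exists T, op_cvg (average_partial ^~ x) T.
Proof. exact: op_cvg_square_sum (opnorm_ge0 x) (rnorm_corner_le x). Qed.

Lemma unbounded_expectation_ex : (forall g, exists n, e n = g) ->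
  exists chi sigma, unbounded_expectation A alpha chi sigma.
Proof.
move=> e_surj; have [sigma0 sigma0P] := choice average_ex.
have coef0 g : 0 < coef e g :> R by exact: coef_gt0.
(* The unit is L_1 Psi 1, so unitality requires chi 1 = 1. *)
pose k : R := (coef e 1%g)^-1.
have k0 : 0 < k by rewrite invr_gt0.
pose chi g : R := k * coef e g; pose sigma x := k%:C *: sigma0 x.
have sigmaP x : op_cvg (fun N => k%:C *: average_partial N x) (sigma x).
  by apply: op_cvgZ; exact: sigma0P.
have fourier g r : A r -> sigma (translation g * Psi alpha r) =
    (chi g)%:C *: (translation g * Psi alpha r).
  move=> Ar; apply: (op_cvg_unique (sigmaP _)).
  pose T : 'B(ell2 G H) := translation g * Psi alpha r.
  have TN N : average_partial N T = (coef_partial e N g)%:C *: T.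
    exact: average_partial_fourier.
  exists (fun N => k * opnorm T * `|coef e g - coef_partial e N g|).
    rewrite -(mulr0 (k * opnorm T)); apply: cvgM; first exact: cvg_cst.
    rewrite -(normr0 R) -(subrr (coef e g)); apply: cvg_norm.
    by apply: cvgB; [exact: cvg_cst|exact: coef_partial_cvg].
  move=> N f; rewrite -/T TN.
  have -> : ((chi g)%:C *: T) f - (k%:C *: ((coef_partial e N g)%:C *: T)) f =
      (k * (coef e g - coef_partial e N g))%:C *: T f.
    by rewrite !bopZE scalerA -scalerBl mulrBr rmorphB /chi !rmorphM.
  rewrite rnormZr normrM (ger0_norm (ltW k0)) -!mulrA ler_wpM2l ?(ltW k0)//.
  by rewrite [leRHS]mulrCA ler_wpM2l// rnorm_opnorm.
exists chi, sigma; split.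
- move=> x; apply: op_cvg_uw_closure (sigmaP x) => N.
  by apply: subspaceZ (average_partial_mem N x); exact: lspan_subspace.
- move=> a x y; apply: (op_cvg_unique (sigmaP _)).
  have kE N : k%:C *: average_partial N (a *: x + y) =
      a *: (k%:C *: average_partial N x) + k%:C *: average_partial N y.
    by rewrite average_partial_linear scalerDr !scalerA [k%:C * a]mulrC.
  rewrite (funext kE); exact: (op_cvgD (op_cvgZ a (sigmaP x)) (sigmaP y)).
- have := fourier 1%g 1 (vn_one A_vn).
  rewrite translation1 (sh_one sh) mulr1 => ->.
  by rewrite /chi /k mulVf ?gt_eqF// scale1r.
- move=> n M _ M0.
  have sM : op_cvg (fun N => mxop (fun i j => k%:C *: average_partial N (M i j)))
      (mxop (fun i j => sigma (M i j))).
    by apply: op_cvg_mxop => i j; exact: sigmaP.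
  have s0 : op_ge0 (mxop (fun i j => sigma (M i j))).
    move=> v; apply: (op_cvg_ge0 sM) => N.
    have -> : mxop (fun i j => k%:C *: average_partial N (M i j)) =
        k%:C *: mxop (fun i j => average_partial N (M i j)).
      apply: bop_eqP => w; apply: ell2_eqP => i.
      by rewrite bopZE ell2ZE !mxopE scaler_sumr.
    rewrite bopZE innerZl mulr_ge0 ?ler0c ?(ltW k0)//.
    by apply: average_partial_cp; exact/mxop_ge0P.
  move=> v; have /mxop_ge0P/(_ v) := s0; congr (0 <= _).
  by apply: eq_bigr => i _; apply: eq_bigr => j _; rewrite mxE.
- move=> r s x Ar As; apply: (op_cvg_unique (sigmaP _)).
  have kE N : k%:C *: average_partial N (Psi alpha r * x * Psi alpha s) =
      Psi alpha r * (k%:C *: average_partial N x) * Psi alpha s.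
    rewrite average_partial_bimodular//; apply: bop_eqP => f.
    by rewrite !(bopME, bopZE) linearZ.
  rewrite (funext kE).
  exact: (op_cvgMr (Psi alpha s) (op_cvgMl (Psi alpha r) (sigmaP x))).
- move=> n g c; have := coef_positive_definite e g c.
  move=> /(mulr_ge0 (_ : 0 <= k%:C)) => h.
  have := h _; rewrite ler0c (ltW k0) => /(_ isT).
  rewrite mulr_sumr; congr (0 <= _); apply: eq_bigr => i _.
  rewrite mulr_sumr; apply: eq_bigr => j _.
  by rewrite /chi rmorphM/= mulrCA.
- by move=> g; rewrite mulr_gt0.
- exact: fourier.
- move=> x g.
  have K0 : 0 <= chi g * opnorm x by rewrite mulr_ge0 ?opnorm_ge0 ?mulr_ge0 ?ltW.
  apply: opnorm_le => // f.
  pose u N : 'B(ell2 G H) := Diag (translation g^-1%g * (k%:C *: average_partial N x)).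
  apply: (@op_cvg_le _ _ _ u).
    have [r r0 rP] := op_cvgMl (translation g^-1%g) (sigmaP x).
    exists (fun N => `|r N|); first by rewrite -(normr0 R); exact: cvg_norm.
    move=> N h; rewrite /u.
    set S := translation g^-1%g * sigma x; set S' := translation g^-1%g * _.
    have -> : Diag S h - Diag S' h = Diag (S - S') h.
      by apply: ell2_eqP => i; rewrite ell2DE ell2NE !DiagE.
    apply: rnorm_Diag_le => // h'.
    by rewrite bopDE bopNE (le_trans (rP N h'))// ler_wpM2r ?rnorm_ge0// ler_norm.
  move=> N; rewrite /u.
  have -> : Diag (translation g^-1%g * (k%:C *: average_partial N x)) f =
      k%:C *: Diag (translation g^-1%g * average_partial N x) f.
    by apply: ell2_eqP => i; rewrite ell2ZE !DiagE !bopME bopZE linearZ.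
  rewrite rnormZr (ger0_norm (ltW k0)) /chi -!mulrA ler_wpM2l ?(ltW k0)//.
  by rewrite mulrA rnorm_Diag_average_partial.
Qed.

End Expectation.

(** * Existence of the unbounded expectation *)

Theorem theorem5p2 (R : realType) (H : hilbertType R) (A : set 'B(H))
    (G : groupType) (alpha : G -> 'B(H) -> 'B(H))
    (A_vn : von_neumann_algebra A) (A_injective : injective_algebra A)
    (G_countable : countable [set: G]) (alpha_action : star_action A alpha) :
  exists (chi : G -> R) (sigma : 'B(ell2 G H) -> 'B(ell2 G H)),
    unbounded_expectation A alpha chi sigma.
Proof.
have [E [E_lin E_cp E_mem E_id]] : exists psi : 'B(H) -> 'B(H),
    [/\ linear_on setT psi, completely_positive_on setT psi, psi @` setT `<=` A &
        forall T, A T -> psi T = id T].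
  apply: (A_injective _ A setT id) => //.
  - exact: von_neumann_operator_system.
  - move=> n M AM M0; suff -> : map_mx id M = M by [].
    by apply/matrixP => i j; rewrite mxE.
  - by rewrite image_id.
have [f f_inj] : exists f : G -> nat, {in [set: G] &, injective f}.
  by move/countable_injP : G_countable.
(* The enumeration takes the value 1 outside the range of the injection f. *)
pose e n := xget 1%g [set g | f g = n].
apply: (@unbounded_expectation_ex _ _ _ _ alpha E e) => // [T|g].
  by apply: E_mem; exists T.
exists (f g); rewrite /e; case: xgetP => [h _ /= fh|/(_ g) []//].
by apply: f_inj => //; rewrite inE.
Qed.
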